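(* Consider the orthogonal regression model with known $\sigma$ described in the context, and let Assumptions (B) and (C) below hold. Let $d\in\mathbb R$ be a fixed constant and consider the mBIC rule, which selects the model $M$ minimizing $$\frac{RSS_M}{\sigma^2}+k(\log n+2\log m+d),\qquad k=k(M).$$ (i) If $mp\to s\in(0,\infty]$ and $\frac{\log(mp)}{\log n}\to0$, then mBIC is ABOS. (ii) If $mp\to s\in(0,\infty]$ and $mp\sqrt{\frac{\log n}{n}}\to0$, then mBIC is consistent.
   Context: Setting. All quantities are indexed by $m$, all limits are for $m\to\infty$, and the index $m$ is suppressed. $n=n_m\in\mathbb N$, $p=p_m\in(0,1)$, $\delta_0,\delta_A>0$ may depend on $m$; $\sigma>0$ and $\nu$ are fixed, $\nu$ being a probability measure on $\mathbb R$ with $\nu(\{0\})=0$, $\nu(-\infty,0)>0$, $\nu(0,\infty)>0$. The model is $Y=X\beta+\epsilon$ with $Y\in\mathbb R^n$, a deterministic $n\times(m+1)$ design matrix $X$ whose first column consists of ones and which satisfies $X'X=nI_{(m+1)\times(m+1)}$ (so $m<n$), and $\epsilon\sim N(0,\sigma^2I_{n\times n})$. The regression coefficients $\beta_1,\dots,\beta_m$ are i.i.d. with law $(1-p)d_0+p\nu$ ($d_0$ = Dirac measure at $0$), independent of $\epsilon$. The intercept is always included; a model $M$ is a subset of the $m$ regressors, $k(M)$ is the number of its regressors (intercept not counted), and $RSS_M$ is the residual sum of squares of the least squares fit. $\hat\beta_i$ is the least squares estimate of $\beta_i$. Put $\delta=\delta_0/\delta_A$, $f=(1-p)/p$. The risk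 $R$ of a selection rule is $\delta_0$ times the expected number of selected regressors with $\beta_i=0$ plus $\delta_A$ times the expected number of non-selected regressors with $\beta_i\neq0$. The Bayes oracle (for large $n$) selects regressor $i$ iff $\hat\beta_i\notin(a_n,b_n)$, where $a_n<0<b_n$ are the unique solutions $a$ of $(1-p)\delta_0=p\,\delta_A\int_{\mathbb R}\exp\left(n\left(a\frac{\mu}{\sigma^2}-\frac{\mu^2}{2\sigma^2}\right)\right)d\nu(\mu)$; its risk is $R^B$. A rule with risk $R$ is ABOS (asymptotically Bayes optimal under sparsity) if $R/R^B\to1$. A rule is consistent if the probability of selecting the true model $\{i:\beta_i\ne0\}$ converges to $1$ as $m\to\infty$. Assumption (B): $n\to\infty$, $p\to0$, $\log\delta=o(\log p)$, and $\delta$ is bounded from above. Assumption (C) (with $C=0$): there is $\epsilon_0>0$ such that $\nu$ has a positive bounded density $\rho$ w.r.t. Lebesgue measure on $[-\epsilon_0,\epsilon_0]$, and $\rho(0^-)=\lim_{\mu\uparrow0}\rho(\mu)$, $\rho(0^+)=\lim_{\mu\downarrow0}\rho(\mu)$ exist and are finite and positive. *)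

(* Defs.v *)
From HB Require Import structures.
From mathcomp Require Import all_boot all_order all_algebra.
From mathcomp Require Import all_classical all_reals all_analysis.
Set Implicit Arguments.
Unset Strict Implicit.
Unset Printing Implicit Defensive.
Import Order.TTheory GRing.Theory Num.Theory.
Import numFieldNormedType.Exports.
Local Open Scope classical_set_scope.
Local Open Scope ring_scope.

Section Regression.
Context {R : realType} {n m : nat}.
Implicit Types (X : 'M[R]_(n, m.+1)) (Y : 'cV[R]_n) (M : {set 'I_m}).

(* Column [ord0] of the design is the intercept; regressor [i : 'I_m] is column
   [lift ord0 i], i.e. column number [i.+1]. *)
Definition orthogonal_design X : Prop :=
  (forall j, X j ord0 = 1) /\ X^T *m X = (n%:R)%:M.

Definition coef_vector (b0 : R) (b : 'I_m -> R) : 'cV[R]_m.+1 :=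
  \col_j (if unlift ord0 j is Some i then b i else b0).

(* A submodel always contains the intercept, so [b ord0 0] is unconstrained. *)
Definition submodel M : set 'cV[R]_m.+1 :=
  [set b | forall i : 'I_m, i \notin M -> b (lift ord0 i) 0 = 0].

Definition RSS X Y M : R :=
  inf [set \sum_j ((Y - X *m b) j 0) ^+ 2 | b in submodel M].

Definition lse X Y (i : 'I_m) : R :=
  (invmx (X^T *m X) *m (X^T *m Y)) (lift ord0 i) 0.

Definition mBIC (sigma d : R) X Y M : R :=
  RSS X Y M / sigma ^+ 2 + #|M|%:R * (ln n%:R + 2 * ln m%:R + d).

(* Ties may be broken arbitrarily. *)
Definition is_mBIC_rule (sigma d : R) X (rule : 'cV[R]_n -> {set 'I_m}) : Prop :=
  forall Y M, mBIC sigma d X Y (rule Y) <= mBIC sigma d X Y M.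

End Regression.

Section BayesOracle.
Context {R : realType}.
Variables (sigma : R) (nu : probability R R) (n : nat) (p delta0 deltaA : R).

Definition oracle_equation (a : R) : Prop :=
  (((1 - p) * delta0)%:E = (p * deltaA)%:E *
    \int[nu]_mu (expR (n%:R * (a * (mu / sigma ^+ 2)
                               - mu ^+ 2 / (2 * sigma ^+ 2))))%:E)%E.

(* The equation has exactly one negative and one positive solution once
   its integral at a = 0 is small enough, hence eventually under the standing
   asymptotics; [0] is a junk value for the other indices. *)
Definition oracle_lower : R := xget 0 [set a | a < 0 /\ oracle_equation a].
Definition oracle_upper : R := xget 0 [set a | 0 < a /\ oracle_equation a].

Definition bayes_oracle {m : nat} (X : 'M[R]_(n, m.+1)) (Y : 'cV[R]_n) :
    {set 'I_m} :=
  [set i | ~~ (oracle_lower < lse X Y i < oracle_upper)]%SET.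

End BayesOracle.

Section Probability.
Context {R : realType} {d : measure_display} {T : measurableType d}.
Variable P : probability T R.

Definition mutually_independent (I : finType) (Z : I -> {RV P >-> R}) : Prop :=
  forall (J : {set I}) (B : I -> set R), (forall i, measurable (B i)) ->
    P (\bigcap_(i in [set` J]) (Z i @^-1` B i)) =
    (\prod_(i in J) P (Z i @^-1` B i))%E.

Definition has_law (Z : {RV P >-> R}) (mu : set R -> \bar R) : Prop :=
  forall B : set R, measurable B -> distribution P Z B = mu B.

Section Model.
Context {n m : nat}.
Variables (X : 'M[R]_(n, m.+1)) (b0 : R).
Variables (beta : 'I_m -> {RV P >-> R}) (eps : 'I_n -> {RV P >-> R}).

Definition response (w : T) : 'cV[R]_n :=
  X *m coef_vector b0 (fun i => beta i w) + \col_j eps j w.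

Definition true_model (w : T) : {set 'I_m} := [set i | beta i w != 0]%SET.

(* Independence of the joint family says that the beta_i are independent,
   the eps_j are independent, and the two vectors are independent. *)
Definition sparse_model (sigma p : R) (nu : probability R R) : Prop :=
  [/\ mutually_independent
        (fun k : 'I_m + 'I_n => match k with inl i => beta i | inr j => eps j end),
      forall i, has_law (beta i)
        (fun B => (1 - p)%:E * \d_(0%R : R) B + p%:E * nu B)%E &
      forall j, has_law (eps j) (normal_prob 0 sigma)].

Definition measurable_rule (rule : 'cV[R]_n -> {set 'I_m}) : Prop :=
  forall i, measurable [set w | i \in rule (response w)].

Definition risk (delta0 deltaA : R) (rule : 'cV[R]_n -> {set 'I_m}) : \bar R :=
  (delta0%:E *
     'E_P[fun w => #|(rule (response w) :\: true_model w)%SET|%:R] +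
   deltaA%:E *
     'E_P[fun w => #|(true_model w :\: rule (response w))%SET|%:R])%E.

End Model.
End Probability.

Section Assumptions.
Context {R : realType}.

Definition assumption_B (n : nat -> nat) (p delta : nat -> R) : Prop :=
  [/\ n @ \oo --> \oo,
      p @ \oo --> (0 : R),
      (fun m => ln (delta m) : R^o) =o_\oo (fun m => ln (p m) : R^o) &
      exists K : R, forall m, delta m <= K].

Definition assumption_C (nu : probability R R) : Prop :=
  exists (e0 K rho0m rho0p : R) (rho : R -> R),
    [/\ 0 < e0,
        measurable_fun `[- e0, e0] rho /\
          (forall x, x \in `[- e0, e0] -> 0 < rho x <= K),
        forall A : set R, measurable A -> A `<=` `[- e0, e0] ->
          nu A = (\int[lebesgue_measure]_(x in A) (rho x)%:E)%E,
        0 < rho0m /\ rho x @[x --> (0 : R)^'-] --> rho0m &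
        0 < rho0p /\ rho x @[x --> (0 : R)^'+] --> rho0p].

End Assumptions.

(* Main.v *)
Require Import Defs.
From HB Require Import structures.
From mathcomp Require Import all_boot all_order all_algebra.
From mathcomp Require Import all_classical all_reals all_analysis.
From mathcomp Require Import measurable_realfun ring lra.
Set Implicit Arguments.
Unset Strict Implicit.
Unset Printing Implicit Defensive.
Import Order.TTheory GRing.Theory Num.Theory.
Import numFieldNormedType.Exports.
Local Open Scope classical_set_scope.
Local Open Scope ring_scope.

(** Write s = sigma / sqrt n for the standard deviation of a least squares
    estimate.  Orthogonality of the design decouples the regressors: the
    standardized estimate of regressor i is beta_i / s plus a standard normal
    variable independent of beta_i, and mBIC selects i when its absolute value
    exceeds c = sqrt (ln n + 2 ln m + d) (lemmas [RSS_orthogonal],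
    [mBIC_threshold_rule]).  The Bayes oracle is a rule of the same kind, with
    cutoffs u on the negative side and v on the positive side which solve an
    equation for the mean likelihood ratio.  So both risks are controlled by one
    statement about threshold rules, [threshold_risk_cvg].

    Missed signals dominate the risk.  A nonzero coefficient is missed when it is
    of order s c or smaller, because then only the behaviour of the prior near
    zero matters: if u / c and v / c tend to 1, the probability of missing a
    signal is asymptotically (rho(0-) + rho(0+)) s c.  This is dominated
    convergence in the noise variable ([miss_prob_cvg]); the dominating function
    is affine in the absolute noise, since for moderate noise the prior has a
    bounded density on the relevant window, and noise large enough to leave that
    range exceeds a multiple of 1 / s.  A false positive has probability at most
    exp (- u^2 / 2) + exp (- v^2 / 2).  For mBIC the penalty 2 ln m makes this of
    order 1 / (m sqrt n), and the assumption that m p stays away from zero makes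
    the contribution to the risk smaller than that of the missed signals by a
    factor c.

    For the oracle, let q = (1 - p) delta0 / (p deltaA).  Completing the square
    shows that the mean likelihood ratio at an estimate b is s exp ((b / s)^2 / 2)
    up to constant factors, as long as b stays near zero
    ([mean_lr_root_bounds]), and it is too large for b away from zero since q is
    O(s^-2) ([mean_lr_large]).  Hence any root has q exp (- u^2 / 2) = O(s), which
    makes the oracle's false positives negligible, and
    u^2 = 2 ln (q / s) + O(1).  The difference between c^2 and 2 ln (q / s) is
    2 ln (m p) - 2 ln delta + O(1), which is o(c^2) under the assumptions
    ([ln_null_odds_cvg]), so that u / c and v / c tend to 1.  After division by
    m p deltaA s c both risks have the limit rho(0-) + rho(0+), and (i) follows.

    For (ii), the probability of any error is at most the expected number of
    errors, that is, at most 2 m exp (- c^2 / 2), which is O(1 / sqrt n), plus m p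
    times the probability of missing a signal, which is
    O(m p sqrt (ln n / n)). *)

(** * Integration against a density *)

Section Density.
Local Open Scope ereal_scope.
Context d (T : measurableType d) (R : realType).
Variables (mu m : {measure set T -> \bar R}) (g : T -> R).
Hypothesis mg : measurable_fun [set: T] g.
Hypothesis g0 : forall x, (0 <= g x)%R.
Hypothesis mE : forall A, measurable A -> m A = \int[mu]_(x in A) (g x)%:E.

Import HBNNSimple.

(** For simple functions the identity is the hypothesis on [m]; monotone
    convergence along simple approximations of [f] gives the general case. *)
Lemma ge0_integral_density (f : T -> \bar R) :
  measurable_fun [set: T] f -> (forall x, 0 <= f x) ->
  \int[m]_x f x = \int[mu]_x (f x * (g x)%:E).
Proof.
move=> mf f0.
pose f_ := nnsfun_approx measurableT mf.
have fE x : EFin \o f_^~ x @ \oo --> f x.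
  by apply: (@cvg_nnsfun_approx _ _ _ setT).
have f_nd x : {homo (fun n => f_ n x) : k l / (k <= l)%N >-> (k <= l)%R}.
  by move=> k l kl; exact/lefP/nd_nnsfun_approx.
transitivity (limn (fun n => \int[m]_x (f_ n x)%:E)).
  rewrite -monotone_convergence//.
  - by apply: eq_integral => x _; apply/esym/cvg_lim => //; exact: fE.
  - by move=> n; exact/measurable_EFinP/measurable_funP.
  - by move=> n y _; rewrite lee_fin.
  - by move=> y _ k l kl; rewrite lee_fin; exact: f_nd.
transitivity (limn (fun n => \int[mu]_x ((f_ n x)%:E * (g x)%:E))); last first.
  rewrite -monotone_convergence//.
  - apply: eq_integral => x _; apply/cvg_lim => //.
    by apply: cvgeZr => //; exact: fE.
  - by move=> n; apply: emeasurable_funM; exact/measurable_EFinP.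
  - by move=> n y _; rewrite mule_ge0// lee_fin.
  - by move=> y _ k l kl; rewrite lee_pmul// ?lee_fin//; exact: f_nd.
congr (limn _); apply/funext => n.
transitivity (\sum_(k \in range (f_ n)) k%:E * m (f_ n @^-1` [set k])).
  rewrite integralT_nnsfun sintegralE //.
transitivity (\sum_(k \in range (f_ n))
    \int[mu]_x ((k * \1_(f_ n @^-1` [set k]) x)%:E * (g x)%:E)).
  apply: eq_fsbigr => k /set_mem [x _ xk].
  have k0 : (0 <= k)%R by rewrite -xk.
  rewrite mE//.
  under [RHS]eq_integral do rewrite EFinM -muleA.
  rewrite ge0_integralZl//; last 2 first.
  - by apply: emeasurable_funM; apply/measurable_EFinP => //; exact: measurable_indic.
  - by move=> y _; rewrite mule_ge0// lee_fin.
  congr (_ * _); rewrite integral_mkcond; apply: eq_integral => y _.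
  rewrite /patch indicE; case: ifPn => _; by rewrite ?mul1e ?mul0e.
rewrite -ge0_integral_fsum//; last 2 first.
- move=> k; apply: emeasurable_funM; apply/measurable_EFinP => //.
  by apply: measurable_funM => //; exact: measurable_indic.
- move=> k x _; rewrite mule_ge0// ?lee_fin//.
  exact: nnfun_muleindic_ge0.
apply: eq_integral => x _.
rewrite [in RHS]fimfunE -fsumEFin//.
rewrite ge0_mule_fsuml// => k.
exact: nnfun_muleindic_ge0.
Qed.

End Density.

(** * Gaussian measures: affine images and convolution *)

Section Affine.
Context {R : realType}.
Implicit Types a b m s t x z : R.
Local Notation mu := (@lebesgue_measure R).

Lemma measurable_EFin_normal_pdf m s (D : set R) :
  measurable_fun D (fun x => (normal_pdf m s x)%:E).
Proof.
by apply: measurable_funTS; apply: measurableT_comp => //; exact: measurable_normal_pdf.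
Qed.

Let measurable_restrict_normal_pdf m s (D : set R) : measurable D ->
  measurable_fun [set: R] ((fun x => (normal_pdf m s x)%:E) \_ D).
Proof.
move=> mD; apply: (measurable_restrictT (fun x => (normal_pdf m s x)%:E) mD).1.
exact: measurable_EFin_normal_pdf.
Qed.

Lemma measurable_affine a b : measurable_fun [set: R] (fun x => a * x + b).
Proof. by apply: measurable_funD => //; exact: measurable_funM. Qed.

(** Lebesgue measure is determined by its values on half-open intervals, and the
    preimage of such an interval is an interval of length divided by [`|a|]; for
    negative [a] the closed end is on the other side. *)
Lemma lebesgue_measure_affine a b (A : set R) : a != 0 -> measurable A ->
  mu ((fun x => a * x + b) @^-1` A) = ((`|a|^-1)%:E * mu A)%E.
Proof.
move=> a0 mA.
have na0 : `|a| != 0 by rewrite normr_eq0.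
pose phi : measurableTypeR R -> measurableTypeR R := fun x => a * x + b.
have mphi : measurable_fun setT phi := measurable_affine a b.
pose k : {nonneg R} := NngNum (normr_ge0 a).
pose nu' : {measure set (measurableTypeR R) -> \bar R} :=
  mscale k (pushforward mu phi).
suff -> : mu A = nu' mphi A.
  by rewrite /nu' /= /mscale /= muleA -EFinM mulVf// mul1e.
apply: lebesgue_measure_unique => // _ [[x y] _ <-] /=.
rewrite /nu' /= /mscale /= /pushforward /= lebesgue_measure_itv/=.
have [xy|yx] := ltP x y; last first.
  by rewrite (_ : _ @^-1` _ = set0) ?measure0 ?mule0 ?lte_fin ?ltNge ?yx// set_itv_ge// -leNgt.
rewrite lte_fin xy.
have [a_gt0|a_lt0|] := ltgtP 0 a; last by move=> a00; rewrite -a00 eqxx in a0.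
- rewrite (_ : _ @^-1` _ = `](x - b) / a, (y - b) / a]%classic); last first.
    apply/seteqP; split=> z /=; rewrite !in_itv/= ltr_pdivrMr// ler_pdivlMr// (mulrC z).
      by rewrite ltrBlDr lerBrDr.
    by rewrite ltrBlDr lerBrDr.
  rewrite lebesgue_measure_itv/= lte_fin ltr_pM2r ?invr_gt0// ltrD2r xy.
  rewrite -!EFinD -EFinM gtr0_norm//; congr EFin; field.
  by rewrite gt_eqF.
- rewrite (_ : _ @^-1` _ = `[(y - b) / a, (x - b) / a[%classic); last first.
    apply/seteqP; split=> z /=; rewrite !in_itv/= ltr_ndivlMr// ler_ndivrMr// (mulrC z).
      by rewrite ltrBlDr lerBrDr andbC.
    by rewrite ltrBlDr lerBrDr andbC.
  rewrite lebesgue_measure_itv/= lte_fin ltr_nM2r ?invr_lt0// ltrD2r xy.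
  rewrite -!EFinD -EFinM ltr0_norm//; congr EFin; field.
  by rewrite lt_eqF.
Qed.

Lemma ge0_integral_affine a b (f : R -> \bar R) : a != 0 ->
  measurable_fun [set: R] f -> (forall x, 0 <= f x)%E ->
  (\int[mu]_x f (a * x + b)%R = (`|a|^-1)%:E * \int[mu]_x f x)%E.
Proof.
move=> a0 mf f0.
pose phi : measurableTypeR R -> measurableTypeR R := fun x => a * x + b.
have mphi : measurable_fun setT phi := measurable_affine a b.
have ka0 : 0 <= `|a|^-1 by rewrite invr_ge0.
pose k : {nonneg R} := NngNum ka0.
rewrite (_ : (_ * _)%E = \int[mscale k mu]_x f x)%E; last first.
  by rewrite ge0_integral_mscale.
rewrite -(@ge0_integral_pushforward _ _ _ _ _ phi mphi mu setT)//.
apply: eq_measure_integral => A mA _.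
by rewrite /= /pushforward lebesgue_measure_affine.
Qed.

Lemma normal_pdf_affine m s a b x : a != 0 -> s != 0 ->
  normal_pdf (a * m + b) (a * s) (a * x + b) = `|a|^-1 * normal_pdf m s x.
Proof.
move=> a0 s0; rewrite !normal_pdfE ?mulf_neq0// mulrA; congr (_ * _).
  rewrite /normal_peak -sqrtr_sqr -invfM -sqrtrM ?sqr_ge0//.
  by congr (Num.sqrt _)^-1; ring.
rewrite /normal_fun; congr expR.
have -> : a * x + b - (a * m + b) = a * (x - m) by ring.
by field; rewrite s0 a0.
Qed.

Lemma normal_prob_affine m s a b (A : set R) : a != 0 -> s != 0 -> measurable A ->
  normal_prob m s ((fun x => a * x + b) @^-1` A) =
  normal_prob (a * m + b) (a * s) A.
Proof.
move=> a0 s0 mA.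
have na0 : `|a| != 0 by rewrite normr_eq0.
rewrite /normal_prob integral_mkcond [RHS]integral_mkcond.
rewrite -[RHS]mul1e -(divff na0) EFinM -muleA -(ge0_integral_affine b)//=; last 2 first.
- exact: measurable_restrict_normal_pdf.
- move=> x; rewrite patchE; case: ifP => // _; rewrite lee_fin; exact: normal_pdf_ge0.
rewrite -ge0_integralZl//=; last 2 first.
- apply: (@measurableT_comp _ _ _ _ _ _ (_ \_ A)); last exact: measurable_affine.
  exact: measurable_restrict_normal_pdf.
- move=> x _; rewrite patchE; case: ifP => // _; rewrite lee_fin; exact: normal_pdf_ge0.
apply: eq_integral => x _; rewrite !patchE.
rewrite (_ : (x \in _ @^-1` A) = (a * x + b \in A)); last by apply/idP/idP; rewrite !inE.
case: ifP => _; last by rewrite mule0.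
by rewrite normal_pdf_affine// -EFinM mulrA divff// mul1r.
Qed.

(** Completing the square in [x]: the second factor on the right is again a
    density in [x], so integrating over [x] leaves the density of the sum. *)
Lemma normal_pdf_conv s t r x z : s != 0 -> t != 0 -> r != 0 -> r ^+ 2 = s ^+ 2 + t ^+ 2 ->
  normal_pdf 0 s x * normal_pdf x t z =
  normal_pdf 0 r z * normal_pdf (z * s ^+ 2 / r ^+ 2) (s * t / r) x.
Proof.
move=> s0 t0 r0 rE; rewrite !normal_pdfE ?mulf_neq0 ?invr_neq0//.
rewrite mulrACA [RHS]mulrACA; congr (_ * _).
  rewrite /normal_peak -!invfM -!sqrtrM; try by rewrite mulrn_wge0// mulr_ge0 ?sqr_ge0// pi_ge0.
  by congr (Num.sqrt _)^-1; field.
rewrite /normal_fun -!expRD; congr expR.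
have st0 : s ^+ 2 + t ^+ 2 != 0 by rewrite -rE expf_neq0.
rewrite exprMn exprVn exprMn rE; field.
by rewrite s0 t0 st0.
Qed.

End Affine.

Section Convolution.
Context {R : realType}.
Implicit Types c s t r : R.
Local Notation mu := (@lebesgue_measure R).

Lemma ge0_integral_normal_prob m s (f : R -> \bar R) :
  measurable_fun [set: R] f -> (forall x, 0 <= f x)%E ->
  (\int[normal_prob m s]_x f x = \int[mu]_x (f x * (normal_pdf m s x)%:E))%E.
Proof.
move=> mf f0; apply: ge0_integral_density => //.
- exact: measurable_normal_pdf.
- exact: normal_pdf_ge0.
Qed.

(** In the double integral of the densities of the two terms, integrating over the
    first term first leaves, by [normal_pdf_conv], the density of the sum. *)
Lemma normal_prob_conv s t r c (A : set R) : s != 0 -> t != 0 -> c != 0 -> 0 < r ->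
  r ^+ 2 = s ^+ 2 + (c * t) ^+ 2 -> measurable A ->
  (normal_prob 0 s \x normal_prob 0 t)%E [set z | A (z.1 + c * z.2)] =
  normal_prob 0 r A.
Proof.
move=> s0 t0 c0 r_gt0 rE mA.
have r0 : r != 0 by rewrite gt_eqF.
have ct0 : c * t != 0 by rewrite mulf_neq0.
have mB : measurable [set z : R * R | A (z.1 + c * z.2)].
  rewrite -[X in measurable X]setTI.
  suff : measurable_fun [set: R * R] (fun z : R * R => z.1 + c * z.2) by exact.
  by apply: measurable_funD => //; exact: measurable_funM.
have mpdf2 : measurable_fun [set: R * R] (fun z : R * R => normal_pdf z.1 (c * t) z.2).
  under eq_fun do rewrite normal_pdfE//.
  apply: measurable_funM => //; rewrite /normal_fun.
  apply: measurableT_comp => //; apply: measurable_funM => //.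
  apply: measurableT_comp => //; apply: measurable_funX => //.
  exact: measurable_funB.
pose F (z : R * R) : \bar R :=
  ((\1_A z.2)%:E * (normal_pdf 0 s z.1 * normal_pdf z.1 (c * t) z.2)%:E)%E.
have mF : measurable_fun setT F.
  apply: emeasurable_funM; apply: measurableT_comp => //.
    by apply: measurableT_comp => //; exact: measurable_indic.
  apply: measurable_funM => //.
  by apply: measurableT_comp; first exact: measurable_normal_pdf.
have F0 z : (0 <= F z)%E.
  by rewrite mule_ge0// lee_fin// mulr_ge0// normal_pdf_ge0.
transitivity (\int[mu]_x \int[mu]_z F (x, z))%E; last first.
  rewrite fubini_tonelli// /normal_prob [RHS]integral_mkcond.
  apply: eq_integral => z _; rewrite /F/= patchE.
  rewrite indicE; case: ifP => _ /=; last first.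
    by rewrite integral0_eq// => x _; rewrite mul0e.
  under eq_integral do rewrite mul1e (normal_pdf_conv _ _ s0 ct0 r0 rE) EFinM.
  rewrite ge0_integralZl//=.
  - by rewrite integral_normal_pdf mule1.
  - exact: measurable_EFin_normal_pdf.
  - by move=> x _; rewrite lee_fin normal_pdf_ge0.
  - by rewrite lee_fin normal_pdf_ge0.
rewrite /product_measure1/= ge0_integral_normal_prob//; last first.
  exact: measurable_fun_xsection.
apply: eq_integral => x _; rewrite /=.
rewrite (_ : xsection _ x = (fun y => c * y + x) @^-1` A); last first.
  by apply/seteqP; split=> y /=; rewrite /xsection/= inE/= addrC.
rewrite normal_prob_affine// mulr0 add0r muleC /normal_prob.
rewrite -ge0_integralZl//=; last 3 first.
- exact: measurable_EFin_normal_pdf.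
- by move=> z _; rewrite lee_fin normal_pdf_ge0.
- by rewrite lee_fin normal_pdf_ge0.
rewrite integral_mkcond; apply: eq_integral => z _.
by rewrite patchE /F/= indicE -EFinM; case: ifP => _; rewrite ?mul1e ?mul0e.
Qed.

End Convolution.

(** * Gaussian tails and independent Gaussian combinations *)

Section GaussianTail.
Context {R : realType}.

(** On [A] the density of N(0, 1) is at most [exp (- c ^ 2 / 2)] times the density
    of N(c, 1), whose total mass is one. *)
Let normal_prob_shift_le (c : R) (A : set R) : measurable A ->
  (forall x, A x -> c ^+ 2 <= c * x) ->
  (normal_prob 0 1 A <= (expR (- (c ^+ 2 / 2)))%:E)%E.
Proof.
move=> mA cA.
apply: (@le_trans _ _ ((expR (- (c ^+ 2 / 2)))%:E * normal_prob c 1 A)%E); last first.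
  rewrite muleC gee_pMl ?fin_num_measure// ?lee_fin ?expR_ge0//.
  exact: probability_le1.
rewrite /normal_prob -ge0_integralZl//=; last 2 first.
- exact: measurable_EFin_normal_pdf.
- by move=> x _; rewrite lee_fin normal_pdf_ge0.
apply: ge0_le_integral => //=.
- by move=> x _; rewrite lee_fin normal_pdf_ge0.
- exact: measurable_EFin_normal_pdf.
- by apply: emeasurable_funM => //; exact: measurable_EFin_normal_pdf.
move=> x /cA cx; rewrite -EFinM lee_fin !normal_pdfE ?oner_neq0//.
rewrite mulrCA ler_wpM2l ?normal_peak_ge0// /normal_fun -expRD ler_expR.
rewrite expr1n; lra.
Qed.

Lemma normal_prob_right_tail (c : R) : 0 <= c ->
  (normal_prob 0 1 `[c, +oo[%classic <= (expR (- (c ^+ 2 / 2)))%:E)%E.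
Proof.
move=> c0; apply: normal_prob_shift_le => // x /=.
by rewrite in_itv/= andbT expr2 => cx; rewrite ler_wpM2l.
Qed.

Lemma normal_prob_left_tail (c : R) : 0 <= c ->
  (normal_prob 0 1 `]-oo, (- c)%R]%classic <= (expR (- (c ^+ 2 / 2)))%:E)%E.
Proof.
move=> c0; rewrite -(sqrrN c); apply: normal_prob_shift_le => // x /=.
by rewrite in_itv/= expr2 => cx; rewrite ler_wnM2l// oppr_le0.
Qed.

End GaussianTail.

Section PairLaw.
Local Open Scope ereal_scope.
Context d d1 d2 (T : measurableType d) (T1 : measurableType d1)
  (T2 : measurableType d2) (R : realType) (P : probability T R).

(** A finite measure on a product is determined by its values on rectangles.  The
    event [F] serves two purposes: it carries the remaining independent variables
    in the induction of [lincomb_gaussian], and it restricts to nonzero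
    coefficients in [prob_noise_coef_neq0]. *)
Lemma pair_law (m1 : probability T1 R) (m2 : probability T2 R)
    (X : T -> T1) (Y : T -> T2) (F : set T) (q : R) :
  measurable_fun [set: T] X -> measurable_fun [set: T] Y -> measurable F -> (0 <= q)%R ->
  (forall A B, measurable A -> measurable B ->
     P (X @^-1` A `&` Y @^-1` B `&` F) = m1 A * m2 B * q%:E) ->
  forall E, measurable E ->
    P ((fun w => (X w, Y w)) @^-1` E `&` F) = (m1 \x m2) E * q%:E.
Proof.
move=> mX mY mF q0 H E mE.
pose phi (w : T) : T1 * T2 := (X w, Y w).
have mphi : measurable_fun [set: T] phi by apply: measurable_fun_pair.
have mpre E' : measurable E' -> measurable (phi @^-1` E').
  by move=> mE'; rewrite -[X in measurable X]setTI; exact: mphi.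
have [qE0|qneq0] := eqVneq q 0%R.
  rewrite qE0 mule0; apply/eqP; rewrite -measure_le0.
  have := H setT setT measurableT measurableT.
  rewrite qE0 mule0 !preimage_setT !setTI => <-.
  by apply: le_measure; rewrite ?inE//; exact: measurableI (mpre _ mE) mF.
have qi0 : (0 <= q^-1)%R by rewrite invr_ge0.
pose m' := mscale (NngNum qi0) (pushforward (mrestr P mF) phi).
have := @product_measure_unique _ _ _ _ R m1 m2 (m' mphi).
move=> /(_ _ E mE) -> /=.
  by rewrite /mscale/= /pushforward/= /mrestr muleC muleA -EFinM divff// mul1e.
move=> A B mA mB; rewrite /= /mscale/= /pushforward/= /mrestr.
have -> : phi @^-1` (A `*` B) = X @^-1` A `&` Y @^-1` B by apply/seteqP; split.
by rewrite H// [_ * q%:E]muleC muleA -EFinM mulVf// mul1e.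
Qed.

End PairLaw.

Section GaussianCombination.
Context d (T : measurableType d) (R : realType) (P : probability T R).
Context (K : finType) (Z : K -> {RV P >-> R}) (sigma : R) (c : K -> R).
Hypothesis sigma_neq0 : sigma != 0.
Hypothesis indepZ : mutually_independent Z.

Let F (J : {set K}) (B : K -> set R) : set T := \bigcap_(i in [set` J]) (Z i @^-1` B i).

Let mF J B : (forall i, measurable (B i)) -> measurable (F J B).
Proof.
move=> mB; apply: fin_bigcap_measurable; first exact: finite_finset.
by move=> i _; rewrite -[X in measurable X]setTI; exact: measurable_funP.
Qed.

Let update (B : K -> set R) k C i := if i == k then C else B i.

Let mupdate B k C : (forall i, measurable (B i)) -> measurable C ->
  forall i, measurable (update B k C i).
Proof. by move=> mB mC i; rewrite /update; case: ifP. Qed.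

Let FU (J : {set K}) B k C : k \notin J -> F (k |: J) (update B k C) = Z k @^-1` C `&` F J B.
Proof.
move=> kJ; apply/seteqP; split=> w.
  move=> h; split.
    by have := h k; rewrite /update eqxx; apply; rewrite /= !inE eqxx.
  move=> i /= iJ; have := h i; rewrite /update.
  case: eqVneq => [ik|_]; first by rewrite ik (negbTE kJ) in iJ.
  by apply; rewrite /= !inE iJ orbT.
move=> [hk hJ] i /=; rewrite !inE /update; case: eqVneq => [->//|_ /=]; exact: hJ.
Qed.

Let PFU (J : {set K}) B k C : k \notin J -> (forall i, measurable (B i)) -> measurable C ->
  P (Z k @^-1` C `&` F J B) = (P (Z k @^-1` C) * P (F J B))%E.
Proof.
move=> kJ mB mC; rewrite -FU// indepZ; last exact: mupdate.
rewrite big_setU1//= /update eqxx; congr (_ * _)%E.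
rewrite indepZ//; apply: eq_bigr => i iJ; case: eqVneq => // ik.
by rewrite -ik iJ in kJ.
Qed.

Definition lincomb (s : seq K) (w : T) : R := \sum_(k <- s) c k * Z k w.

Lemma measurable_lincomb s : measurable_fun [set: T] (lincomb s).
Proof.
by rewrite /lincomb; apply: measurable_sum => k; exact: measurable_funM.
Qed.

(** Induction on [s].  The statement must include an event about the variables
    outside [s]: when a variable joins the sum, the induction hypothesis is used
    with this variable in the event, which yields the joint law of the new term
    and the old sum.  A vanishing variance is excluded because the normal measure
    with zero deviation is not a point mass; so a sum whose tail has zero
    variance needs a separate treatment. *)
Lemma lincomb_gaussian (s : seq K) (J : {set K}) (B : K -> set R) (A : set R) :
  uniq s -> {in s, forall k, has_law (Z k) (normal_prob 0 sigma)} ->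
  {in s, forall k, k \notin J} ->
  0 < \sum_(k <- s) (c k * sigma) ^+ 2 ->
  (forall i, measurable (B i)) -> measurable A ->
  P (lincomb s @^-1` A `&` F J B) =
  (normal_prob 0 (Num.sqrt (\sum_(k <- s) (c k * sigma) ^+ 2)) A * P (F J B))%E.
Proof.
elim: s J B A => [|k s IH] J B A; first by rewrite big_nil ltxx.
move=> /= /andP[ks us] lawZ sJ v0 mB mA.
have lawZs : {in s, forall k, has_law (Z k) (normal_prob 0 sigma)}.
  by move=> l ls; apply: lawZ; rewrite inE ls orbT.
have sJs : {in s, forall k, k \notin J}.
  by move=> l ls; apply: sJ; rewrite inE ls orbT.
have kJ : k \notin J by apply: sJ; rewrite mem_head.
have lawk C : measurable C -> P (Z k @^-1` C) = normal_prob 0 sigma C.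
  by move=> mC; rewrite -(lawZ k (mem_head _ _) C mC).
have E : lincomb (k :: s) = (fun w => c k * Z k w + lincomb s w).
  by apply/funext => w; rewrite /lincomb big_cons.
have [ck0|ck0] := eqVneq (c k) 0.
  have -> : lincomb (k :: s) = lincomb s.
    by rewrite E; apply/funext => w; rewrite ck0 mul0r add0r.
  move: v0; rewrite big_cons ck0 mul0r expr0n/= add0r => v0.
  exact: IH.
have vs0 : 0 <= \sum_(l <- s) (c l * sigma) ^+ 2.
  by apply: sumr_ge0 => l _; exact: sqr_ge0.
rewrite E big_cons.
have mk C : measurable C -> measurable (Z k @^-1` C).
  by move=> mC; rewrite -[X in measurable X]setTI; exact: measurable_funP.
have [vsE|vsN] := eqVneq (\sum_(l <- s) (c l * sigma) ^+ 2) 0.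
  have S0 w : lincomb s w = 0.
    rewrite /lincomb big_seq big1// => l ls; suff -> : c l = 0 by rewrite mul0r.
    move/eqP: vsE; rewrite psumr_eq0; last by move=> i _; exact: sqr_ge0.
    by move/allP => /(_ l ls) /=; rewrite sqrf_eq0 mulf_eq0 (negbTE sigma_neq0) orbF => /eqP.
  rewrite vsE addr0 sqrtr_sqr.
  have -> : (fun w => c k * Z k w + lincomb s w) @^-1` A =
            Z k @^-1` ((fun x => c k * x + 0) @^-1` A).
    by apply/seteqP; split => w /=; rewrite S0.
  have mA' : measurable ((fun x : R => c k * x + 0) @^-1` A).
    by rewrite -[X in measurable X]setTI; apply: (measurable_affine (c k) 0).
  rewrite (PFU kJ mB mA') (lawk _ mA') (normal_prob_affine _ _ ck0 sigma_neq0 mA).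
  rewrite mulr0 addr0; congr (_ * _)%E.
  rewrite /normal_prob; apply: eq_integral => x _.
  rewrite !normal_pdfE ?normr_eq0 ?mulf_neq0// /normal_peak /normal_fun.
  by rewrite real_normK ?num_real.
have v'0 : 0 < \sum_(l <- s) (c l * sigma) ^+ 2 by rewrite lt_neqAle eq_sym vsN.
set v' := \sum_(l <- s) _ in vs0 vsN v'0 *.
have sv' : Num.sqrt v' != 0 by rewrite gt_eqF// sqrtr_gt0.
have mX : measurable [set z : R * R | A (z.1 + c k * z.2)].
  rewrite -[X in measurable X]setTI.
  suff : measurable_fun [set: R * R] (fun z : R * R => z.1 + c k * z.2) by exact.
  by apply: measurable_funD => //; exact: measurable_funM.
have Pfin : P (F J B) \is a fin_num by rewrite fin_num_measure//; exact: mF.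
have q0 : 0 <= fine (P (F J B)) by rewrite fine_ge0.
rewrite -(@normal_prob_conv _ (Num.sqrt v') sigma _ (c k))//; last 2 first.
- by rewrite sqrtr_gt0 ltr_wpDl ?sqr_ge0.
- by rewrite !sqr_sqrtr// 1?addrC// addr_ge0// sqr_ge0.
rewrite -[P (F J B) in RHS]fineK//.
transitivity (P ((fun w => (lincomb s w, Z k w)) @^-1`
                   [set z : R * R | A (z.1 + c k * z.2)]
                 `&` F J B)).
  by congr (P (_ `&` _)); apply/seteqP; split=> w /=; rewrite addrC.
apply: (@pair_law _ _ _ _ _ _ _ P (normal_prob 0 (Num.sqrt v'))
  (normal_prob 0 sigma) (lincomb s) (Z k) _ _ (measurable_lincomb s)
  (measurable_funP (Z k)) (mF _ mB) q0 _ _ mX).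
move=> A' B' mA' mB'; rewrite fineK// -setIA -FU//.
rewrite (IH (k |: J) (update B k B'))//.
- by rewrite FU// PFU// lawk// muleA.
- move=> l ls; rewrite !inE negb_or sJs// andbT.
  by apply: contraNneq ks => <-.
- exact: mupdate.
Qed.

End GaussianCombination.

(** * Least squares and mBIC in an orthogonal design *)

Section OrthogonalRegression.
Context {R : realType} {n m : nat}.
Variable X : 'M[R]_(n, m.+1).
Hypotheses (n_gt0 : (0 < n)%N) (X_orth : orthogonal_design X).
Implicit Types (Y : 'cV[R]_n) (M : {set 'I_m}).

Let n0 : n%:R != 0 :> R. Proof. by rewrite pnatr_eq0 -lt0n. Qed.

Lemma orthogonal_design_lt : (m < n)%N.
Proof.
have [_ XX] := X_orth.
have <- : \rank (X^T *m X) = m.+1 by rewrite XX -scalemx1 mxrank_scale_nz ?mxrank1.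
exact: leq_trans (mxrankM_maxr _ _) (rank_leq_row _).
Qed.

Lemma orthogonal_design_sqr_col j : \sum_i X i j ^+ 2 = n%:R.
Proof.
have [_ /matrixP /(_ j j)] := X_orth; rewrite !mxE eqxx mulr1n => <-.
by apply: eq_bigr => i _; rewrite mxE expr2.
Qed.

Definition ols Y : 'cV[R]_m.+1 := n%:R^-1 *: (X^T *m Y).

Lemma lse_ols Y i : lse X Y i = ols Y (lift ord0 i) 0.
Proof.
by have [_ XX] := X_orth; rewrite /lse XX invmx_scalar mul_scalar_mx.
Qed.

Let sqr_norm k (v : 'cV[R]_k) := \sum_j (v j 0) ^+ 2.

Let sqr_normE k (v : 'cV[R]_k) : sqr_norm v = (v^T *m v) 0 0.
Proof. by rewrite mxE; apply: eq_bigr => j _; rewrite mxE expr2. Qed.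

(** Pythagoras: the residual of the full fit is orthogonal to the column space. *)
Lemma sum_sqr_residual Y (b : 'cV[R]_m.+1) :
  \sum_j ((Y - X *m b) j 0) ^+ 2 =
  \sum_j ((Y - X *m ols Y) j 0) ^+ 2 + n%:R * \sum_k (ols Y k 0 - b k 0) ^+ 2.
Proof.
have [_ XX] := X_orth.
set e := Y - X *m ols Y; set u := ols Y - b.
have -> : Y - X *m b = e + X *m u by rewrite /e /u mulmxBr addrA subrK.
have Xe : X^T *m e = 0.
  rewrite /e mulmxBr mulmxA XX /ols mul_scalar_mx scalerA divff//.
  by rewrite scale1r subrr.
have eX : e^T *m X = 0 by rewrite -[X]trmxK -trmx_mul Xe trmx0.
rewrite -[LHS]/(sqr_norm _) sqr_normE.
have -> : \sum_k (ols Y k 0 - b k 0) ^+ 2 = sqr_norm u.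
  by apply: eq_bigr => k _; rewrite /u !mxE.
rewrite -[X in _ = X + _]/(sqr_norm e) !sqr_normE.
move: e u Xe eX => e u Xe eX.
have -> : (e + X *m u)^T = e^T + (X *m u)^T by apply/matrixP => a c; rewrite !mxE.
rewrite mulmxDl !mulmxDr mulmxA eX mul0mx addr0.
rewrite trmx_mul -!mulmxA Xe mulmx0 add0r (mulmxA X^T) XX mul_scalar_mx.
by rewrite -scalemxAr !mxE.
Qed.

(** By [sum_sqr_residual] the infimum is attained at the full least squares
    estimate with the coordinates outside [M] replaced by zero. *)
Lemma RSS_orthogonal Y M :
  RSS X Y M = \sum_j ((Y - X *m ols Y) j 0) ^+ 2
              + n%:R * \sum_(i | i \notin M) lse X Y i ^+ 2.
Proof.
set v := RHS.
pose b : 'cV[R]_m.+1 := \col_k (if unlift ord0 k is Some i then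
   if i \in M then ols Y k 0 else 0 else ols Y k 0).
have b0 : b 0 0 = ols Y 0 0 by rewrite [LHS]mxE unlift_none.
have bl i : b (lift ord0 i) 0 = if i \in M then lse X Y i else 0.
  by rewrite [LHS]mxE liftK lse_ols.
have bM : submodel M b by move=> i iM; rewrite bl (negbTE iM).
have sumE (b' : 'cV[R]_m.+1) : \sum_k (ols Y k 0 - b' k 0) ^+ 2 =
    (ols Y 0 0 - b' 0 0) ^+ 2
    + (\sum_(i | i \in M) (lse X Y i - b' (lift ord0 i) 0) ^+ 2
       + \sum_(i | i \notin M) (lse X Y i - b' (lift ord0 i) 0) ^+ 2).
  rewrite big_ord_recl (bigID (fun i => i \in M)) /=; congr (_ + (_ + _));
    by apply: eq_bigr => i _; rewrite lse_ols.
have bE : \sum_j ((Y - X *m b) j 0) ^+ 2 = v.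
  rewrite sum_sqr_residual sumE /v; congr (_ + _ * _).
  rewrite b0 subrr expr0n add0r big1 ?add0r; last first.
    by move=> i iM; rewrite bl iM subrr expr0n.
  by apply: eq_bigr => i iM; rewrite bl (negbTE iM) subr0.
have lbv : lbound [set \sum_j ((Y - X *m b) j 0) ^+ 2 | b in submodel M] v.
  move=> _ [b' b'M <-]; rewrite sum_sqr_residual /v lerD2l ler_wpM2l// sumE.
  rewrite addrA -[leLHS]add0r lerD ?addr_ge0 ?sumr_ge0// ?sqr_ge0//.
    by move=> i _; exact: sqr_ge0.
  by apply: ler_sum => i iM; rewrite b'M// subr0.
apply/eqP; rewrite eq_le; apply/andP; split.
  by rewrite -bE; apply: ge_inf; [exists v | exists b].
by apply: lb_le_inf => //; exists v; exists b.
Qed.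

Variables (sigma d : R) (rule : 'cV[R]_n -> {set 'I_m}).
Hypothesis sigma_gt0 : 0 < sigma.
Hypothesis rule_min : is_mBIC_rule sigma d X rule.

Let pen := ln n%:R + 2 * ln m%:R + d.

(** The criterion is additive over the regressors, so a minimiser can be tested one
    regressor at a time. *)
Let mBIC_D1 Y M i : i \in M ->
  mBIC sigma d X Y (M :\ i)%SET - mBIC sigma d X Y M =
  n%:R * lse X Y i ^+ 2 / sigma ^+ 2 - pen.
Proof.
move=> iM; rewrite /mBIC !RSS_orthogonal (cardsD1 i M) iM natrD.
rewrite [in X in X - _](bigD1 i) ?setD11//=.
have -> : \sum_(j | (j \notin (M :\ i)%SET) && (j != i)) lse X Y j ^+ 2 =
          \sum_(j | j \notin M) lse X Y j ^+ 2.
  apply: eq_bigl => j; rewrite !inE negb_and negbK.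
  by case: (eqVneq j i) => [->|_] /=; rewrite ?iM// andbT.
rewrite -/pen; field.
by rewrite gt_eqF.
Qed.

Lemma mBIC_rule_selected Y i : i \in rule Y ->
  pen <= n%:R * lse X Y i ^+ 2 / sigma ^+ 2.
Proof.
by move=> iM; rewrite -subr_ge0 -(mBIC_D1 _ iM) subr_ge0.
Qed.

Lemma mBIC_rule_unselected Y i : i \notin rule Y ->
  n%:R * lse X Y i ^+ 2 / sigma ^+ 2 <= pen.
Proof.
move=> iM; rewrite -subr_le0 -(@mBIC_D1 Y (i |: rule Y)%SET) ?setU11//.
by rewrite setU1K// subr_le0.
Qed.

End OrthogonalRegression.

(** * Joint law of a coefficient and its estimation error *)

Section CoordinateLaw.
Context {R : realType} {d : measure_display} {T : measurableType d}.
Variable P : probability T R.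
Context {n m : nat}.
Variables (X : 'M[R]_(n, m.+1)) (b0 : R).
Variables (beta : 'I_m -> {RV P >-> R}) (eps : 'I_n -> {RV P >-> R}).
Variables (sigma p : R) (nu : probability R R).
Hypotheses (n_gt0 : (0 < n)%N) (X_orth : orthogonal_design X).
Hypotheses (sigma_gt0 : 0 < sigma) (p_itv : 0 < p < 1).
Hypothesis nu_zero : nu [set 0] = 0%E.
Hypothesis model : sparse_model beta eps sigma p nu.

Let nR0 : 0 < n%:R :> R. Proof. by rewrite ltr0n. Qed.
Let sn0 : 0 < Num.sqrt n%:R :> R. Proof. by rewrite sqrtr_gt0. Qed.

(** The scaling makes [noise] a standard normal variable: it is the estimation
    error in units of its standard deviation [sigma / sqrt n]. *)
Definition noise_coef (i : 'I_m) (j : 'I_n) : R :=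
  X j (lift ord0 i) / (Num.sqrt n%:R * sigma).

Definition noise (i : 'I_m) (w : T) : R := \sum_j noise_coef i j * eps j w.

Lemma measurable_noise i : measurable_fun [set: T] (noise i).
Proof. by rewrite /noise; apply: measurable_sum => j; exact: measurable_funM. Qed.

Lemma lse_response i w :
  lse X (response X b0 beta eps w) i =
  beta i w + sigma / Num.sqrt n%:R * noise i w.
Proof.
have [_ XX] := X_orth.
rewrite lse_ols// /ols /response mulmxDr mulmxA XX mul_scalar_mx scalerDr scalerA.
rewrite mulVf ?gt_eqF// scale1r !mxE liftK; congr (_ + _).
rewrite /noise 2!mulr_sumr; apply: eq_bigr => j _; rewrite !mxE /noise_coef.
rewrite -[X in X^-1 * _ = _](@sqr_sqrtr _ n%:R) ?ler0n//; field.
by rewrite !gt_eqF.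
Qed.

Let Z (k : 'I_m + 'I_n) : {RV P >-> R} :=
  match k with inl i => beta i | inr j => eps j end.

(** [lincomb_gaussian] for the errors, with the coefficient in the event that is
    carried along; the variance is one because the column has squared norm [n]. *)
Lemma noise_indep_coef i (A B : set R) : measurable A -> measurable B ->
  P (noise i @^-1` A `&` beta i @^-1` B) = (normal_prob 0 1 A * P (beta i @^-1` B))%E.
Proof.
have [indep _ leps] := model.
move=> mA mB.
pose c (k : 'I_m + 'I_n) : R := if k is inr j then noise_coef i j else 0.
pose s : seq ('I_m + 'I_n) := [seq inr j | j <- enum 'I_n].
have v1 : \sum_(k <- s) (c k * sigma) ^+ 2 = 1.
  rewrite big_map big_enum /= /noise_coef.
  under eq_bigr => j _.
    rewrite (_ : _ ^+ 2 = n%:R^-1 * X j (lift ord0 i) ^+ 2); last first.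
      rewrite -[in RHS](@sqr_sqrtr _ n%:R) ?ler0n//; field.
      by rewrite !gt_eqF.
    over.
  by rewrite -mulr_sumr orthogonal_design_sqr_col// mulVf// gt_eqF.
have nE : noise i = lincomb Z c s.
  by apply/funext => w; rewrite /lincomb big_map big_enum.
have := @lincomb_gaussian _ T R P _ Z sigma c (lt0r_neq0 sigma_gt0) indep s
  [set inl i]%SET (fun=> B) A.
rewrite v1 sqrtr1 -nE.
have -> : \bigcap_(k in [set` [set inl i]%SET]) (Z k @^-1` B) = beta i @^-1` B.
  apply/seteqP; split=> w; first by move=> /(_ (inl i)); apply; rewrite /= inE.
  by move=> Bw k /=; rewrite inE => /eqP ->.
apply => //.
- by rewrite map_inj_uniq ?enum_uniq// => x y [].
- by move=> k /mapP[j _ ->]; exact: leps.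
- by move=> k /mapP[j _ ->]; rewrite inE.
Qed.

Lemma prob_coef0 i : P (beta i @^-1` [set 0]) = (1 - p)%:E.
Proof.
have [_ lbeta _] := model.
have := lbeta i [set 0] (measurable_set1 _).
rewrite /distribution/= /pushforward => ->.
by rewrite nu_zero mule0 adde0 diracE mem_set// mule1.
Qed.

Lemma prob_noise_coef0 i (A : set R) : measurable A ->
  P (noise i @^-1` A `&` beta i @^-1` [set 0]) = (normal_prob 0 1 A * (1 - p)%:E)%E.
Proof. by move=> mA; rewrite noise_indep_coef// prob_coef0. Qed.

Lemma prob_noise_coef_neq0 i (E : set (measurableTypeR R * R)) : measurable E ->
  P ((fun w => (noise i w, beta i w)) @^-1` E `&` [set w | beta i w != 0]) =
  ((normal_prob 0 1 \x nu) E * p%:E)%E.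
Proof.
have [_ lbeta _] := model.
move=> mE.
have mb0 (B : set R) : measurable B -> measurable (beta i @^-1` B).
  by move=> mB; rewrite -[X in measurable X]setTI; exact: measurable_funP.
have bE : [set w | beta i w != 0] = beta i @^-1` (~` [set 0]).
  by apply/seteqP; split => w /= /eqP.
rewrite bE.
apply: (@pair_law _ _ _ _ _ _ _ P (normal_prob 0 1) nu (noise i) (beta i)) => //.
- exact: measurable_noise.
- by apply: mb0; exact: measurableC.
- by case/andP: p_itv => /ltW.
move=> A B mA mB; rewrite -setIA -preimage_setI noise_indep_coef//; last first.
  by apply: measurableI => //; exact: measurableC.
rewrite -muleA; congr (_ * _)%E.
have := lbeta i (B `&` ~` [set 0]) (measurableI _ _ mB (measurableC (measurable_set1 _))).
rewrite /distribution/= /pushforward => ->.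
rewrite diracE memNset; last by move=> [_ /=]; apply.
rewrite mule0 add0e muleC; congr (_ * _)%E.
rewrite -setDE; rewrite measureD//=.
- have -> : nu (B `&` [set 0]) = 0%E.
    apply/eqP; rewrite -measure_le0 -nu_zero; apply: le_measure; rewrite ?inE//.
    exact: measurableI.
  by rewrite sube0.
- by rewrite ltey_eq fin_num_measure.
Qed.

End CoordinateLaw.

(** * The prior near zero *)

(** The local assumption on the prior, with its constants as parameters: the
    limits [rhom] and [rhop] of the density at zero enter the asymptotic risk. *)
Record prior_near0 (R : realType) (nu : probability R R) (e0 K rhom rhop : R)
    (rho : R -> R) : Prop := PriorNear0 {
  prior_radius_gt0 : 0 < e0;
  prior_density_meas : measurable_fun `[- e0, e0] rho;
  prior_density_bounds : forall x, x \in `[- e0, e0] -> 0 < rho x <= K;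
  prior_densityE : forall A : set R, measurable A -> A `<=` `[- e0, e0] ->
    nu A = (\int[lebesgue_measure]_(x in A) (rho x)%:E)%E;
  prior_density_left_gt0 : 0 < rhom;
  prior_density_left : rho x @[x --> (0 : R)^'-] --> rhom;
  prior_density_right_gt0 : 0 < rhop;
  prior_density_right : rho x @[x --> (0 : R)^'+] --> rhop;
  prior_no_atom : nu [set 0] = 0%E }.

Section PriorNearZero.
Context {R : realType}.
Variables (nu : probability R R) (e0 K rhom rhop : R) (rho : R -> R).
Local Notation mu := (@lebesgue_measure R).
Hypothesis nuP : prior_near0 nu e0 K rhom rhop rho.

Let e0_gt0 := prior_radius_gt0 nuP.
Let rho_meas := prior_density_meas nuP.
Let rho_bounds := prior_density_bounds nuP.
Let nu_density := prior_densityE nuP.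
Let rho_left := prior_density_left nuP.
Let rho_right := prior_density_right nuP.
Let nu_zero := prior_no_atom nuP.

Lemma prior_bound_ge0 : 0 <= K.
Proof.
have /rho_bounds /andP[r0 rK] : 0 \in `[- e0, e0].
  by rewrite in_itv/= oppr_le0 !ltW.
exact: le_trans (ltW r0) rK.
Qed.

Lemma prior_le (hi : R) (A : set R) : measurable A -> A `<=` `[- e0, e0] ->
  (forall x, A x -> rho x <= hi) -> (nu A <= hi%:E * mu A)%E.
Proof.
move=> mA Ae Ahi; rewrite nu_density// -integral_cst//.
apply: ge0_le_integral => //=.
- by move=> x /Ae /rho_bounds /andP[/ltW r0 _]; rewrite lee_fin.
- by apply: measurableT_comp => //; exact: measurable_funS rho_meas.
Qed.

Lemma prior_ge (lo : R) (A : set R) : measurable A -> A `<=` `[- e0, e0] ->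
  (forall x, A x -> lo <= rho x) -> (lo%:E * mu A <= nu A)%E.
Proof.
move=> mA Ae Alo.
have [lo0|lo0] := leP lo 0.
  by apply: (@le_trans _ _ 0%E); rewrite // mule_le0_ge0// lee_fin.
rewrite nu_density// -integral_cst//.
apply: ge0_le_integral => //=.
- by move=> x _; rewrite lee_fin ltW.
- by apply: measurableT_comp => //; exact: measurable_funS rho_meas.
Qed.

Lemma prior_right_window (eps : R) : 0 < eps -> exists2 eta : R, 0 < eta &
  forall (A : set R) , measurable A -> A `<=` `]0, eta[ ->
   ((rhop - eps)%:E * mu A <= nu A <= (rhop + eps)%:E * mu A)%E.
Proof.
move=> eps0; move/cvgrPdist_le : rho_right => /(_ _ eps0).
case=> e1 /= e1_gt0 He.
exists (Num.min e1 e0); first by rewrite lt_min e1_gt0.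
move=> A mA AI.
have Ae : A `<=` `[- e0, e0].
  move=> x /AI /=; rewrite !in_itv/= lt_min => /and3P[x0 _ xe].
  by rewrite (ltW xe) andbT (le_trans _ (ltW x0))// oppr_le0 ltW.
have AH x : A x -> `|rhop - rho x| <= eps.
  move=> /AI /=; rewrite in_itv/= lt_min => /and3P[x0 xe _].
  by apply: He => //=; rewrite sub0r normrN gtr0_norm.
apply/andP; split.
  apply: prior_ge => // x /AH; rewrite ler_norml => /andP[_]; lra.
apply: prior_le => // x /AH; rewrite ler_norml => /andP[+ _]; lra.
Qed.

Lemma prior_left_window (eps : R) : 0 < eps -> exists2 eta : R, 0 < eta &
  forall (A : set R) , measurable A -> A `<=` `]- eta, 0[ ->
   ((rhom - eps)%:E * mu A <= nu A <= (rhom + eps)%:E * mu A)%E.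
Proof.
move=> eps0; move/cvgrPdist_le : rho_left => /(_ _ eps0).
case=> e1 /= e1_gt0 He.
exists (Num.min e1 e0); first by rewrite lt_min e1_gt0.
move=> A mA AI.
have AI' x : A x -> [/\ x < 0, - e1 < x & - e0 < x].
  have le1 : Num.min e1 e0 <= e1 by rewrite ge_min lexx.
  have le2 : Num.min e1 e0 <= e0 by rewrite ge_min lexx orbT.
  move=> /AI /=; rewrite in_itv/= => /andP[h1 h2].
  by split=> //; [apply: le_lt_trans h1|apply: le_lt_trans h1]; rewrite lerN2.
have Ae : A `<=` `[- e0, e0].
  move=> x /AI' [x0 _ xe] /=; rewrite in_itv/= (ltW xe)/=.
  exact: le_trans (ltW x0) (ltW e0_gt0).
have AH x : A x -> `|rhom - rho x| <= eps.
  move=> /AI' [x0 xe _].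
  by apply: He => //=; rewrite sub0r normrN ltr0_norm// ltrNl.
apply/andP; split.
  apply: prior_ge => // x /AH; rewrite ler_norml => /andP[_]; lra.
apply: prior_le => // x /AH; rewrite ler_norml => /andP[+ _]; lra.
Qed.

(** Close to zero the prior is almost the measure with the constant densities
    [rhom] and [rhop] on the two sides. *)
Lemma prior_window (eps : R) : 0 < eps -> exists2 eta : R, 0 < eta &
  forall x y, - eta < x < 0 -> 0 < y < eta ->
   `|fine (nu `[x, y]%classic) - (rhom * - x + rhop * y)| <= eps * (y - x).
Proof.
move=> eps0.
have [e1 e1_gt0 H1] := prior_left_window eps0.
have [e2 e2_gt0 H2] := prior_right_window eps0.
exists (Num.min e1 e2); first by rewrite lt_min e1_gt0.
have le1 : Num.min e1 e2 <= e1 by rewrite ge_min lexx.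
have le2 : Num.min e1 e2 <= e2 by rewrite ge_min lexx orbT.
move=> x y /andP[xe x0] /andP[y0 ye].
have xe1 : - e1 < x by apply: le_lt_trans xe; rewrite lerN2.
have ye2 : y < e2 by apply: lt_le_trans ye _.
have -> : nu `[x, y]%classic = (nu `[x, 0%R[%classic + nu `]0%R, y]%classic)%E.
  have -> : `[x, y]%classic = `[x, 0%R[%classic `|` ([set 0] `|` `]0%R, y]%classic).
    apply/seteqP; split => z /=; rewrite !in_itv/=.
      move=> /andP[xz zy]; case: (ltgtP z 0) => z0.
      - by left; rewrite xz.
      - by right; right; rewrite zy.
      - by right; left.
    case=> [/andP[-> z0]/=|[->|/andP[z0 ->]]].
    - exact: ltW (lt_trans z0 y0).
    - by rewrite !ltW.
    - by rewrite (ltW (lt_trans x0 z0)).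
  have d0 : [disjoint [set (0:R)] & `]0%R, y]%classic].
    by apply/disj_setPS => z [/= -> ]; rewrite in_itv/= ltxx.
  rewrite measureU//=; last 2 first.
  - exact: measurableU.
  - apply/seteqP; split => // z [/=]; rewrite !in_itv/= => /andP[_ z0] [z00|/andP[z1 _]].
      by rewrite z00 ltxx in z0.
    by have := lt_trans z0 z1; rewrite ltxx.
  rewrite measureU//=; last first.
    by apply/seteqP; split => // z [/= ->]; rewrite in_itv/= ltxx.
  by congr (_ + _)%E; rewrite nu_zero add0e.
have m1 : mu `[x, 0%R[%classic = (- x)%:E.
  by rewrite lebesgue_measure_itv/= lte_fin x0 EFinN add0e.
have m2 : mu `]0%R, y]%classic = y%:E.
  by rewrite lebesgue_measure_itv/= lte_fin y0 sube0.
have S1 : `[x, 0%R[%classic `<=` `]- e1, 0[.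
  move=> z /=; rewrite !in_itv/= => /andP[xz ->]; rewrite andbT.
  exact: lt_le_trans xz.
have S2 : `]0%R, y]%classic `<=` `]0, e2[.
  move=> z /=; rewrite !in_itv/= => /andP[-> zy] /=.
  exact: le_lt_trans zy _.
have /andP[] := H1 `[x, 0%R[%classic (measurable_itv _) S1.
have /andP[] := H2 `]0%R, y]%classic (measurable_itv _) S2.
rewrite m1 m2 -(@fineK _ (nu `]0%R, y]%classic)) ?fin_num_measure//.
rewrite -(@fineK _ (nu `[x, 0%R[%classic)) ?fin_num_measure//.
rewrite -!EFinM !lee_fin -EFinD /= => a1 a2 a3 a4.
rewrite ler_norml; apply/andP; split; lra.
Qed.

(** The bounds of the window are asymptotically [- H] and [H], but they need not be
    symmetric: in the application a fixed amount of noise shifts the window by less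
    than the order of its length. *)
Lemma prior_window_cvg (x y H : nat -> R) :
  (\forall k \near \oo, 0 < H k) -> H @ \oo --> (0 : R) ->
  x k / H k @[k --> \oo] --> (-1 : R) -> y k / H k @[k --> \oo] --> (1 : R) ->
  fine (nu `[x k, y k]%classic) / H k @[k --> \oo] --> rhom + rhop.
Proof.
move=> H0 Hcvg xcvg ycvg.
have main : rhom * - (x k / H k) + rhop * (y k / H k) @[k --> \oo] --> rhom + rhop.
  rewrite -[X in _ --> X + _](mulr1 rhom) -[X in _ --> _ + X](mulr1 rhop).
  rewrite -[X in _ --> rhom * X + _](opprK 1).
  by apply: cvgD; apply: cvgM; [exact: cvg_cst|exact: cvgN|exact: cvg_cst|].
apply/cvgrPdist_le => eps eps0.
have e4 : 0 < eps / 8 by rewrite divr_gt0.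
have e2 : 0 < eps / 2 by rewrite divr_gt0.
have [eta eta0 Heta] := prior_window e4.
have h1 : 0 < (1 / 2 : R) by lra.
have heta : 0 < eta / 2 by rewrite divr_gt0.
near=> k.
have Hk : 0 < H k by near: k.
have xk : `|-1 - x k / H k| <= 1 / 2.
  by near: k; move/cvgrPdist_le : xcvg => /(_ _ h1).
have yk : `|1 - y k / H k| <= 1 / 2.
  by near: k; move/cvgrPdist_le : ycvg => /(_ _ h1).
have Hek : `|0 - H k| < eta / 2.
  by near: k; move/cvgrPdist_lt : Hcvg => /(_ _ heta).
have mk : `|(rhom + rhop) - (rhom * - (x k / H k) + rhop * (y k / H k))| <= eps / 2.
  by near: k; move/cvgrPdist_le : main => /(_ _ e2).
have xE : x k = (x k / H k) * H k by rewrite divfK// gt_eqF.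
have yE : y k = (y k / H k) * H k by rewrite divfK// gt_eqF.
move: xk yk Hek mk xE yE; set X := x k / H k; set Y := y k / H k.
rewrite sub0r normrN (gtr0_norm Hk) !ler_norml => xk yk Hek mk xE yE.
have xk' : - eta < x k < 0.
  rewrite xE; apply/andP; split; last by rewrite nmulr_rlt0//; lra.
  rewrite -ltrNl -mulNr; apply: (@le_lt_trans _ _ (2 * H k)); last by lra.
  by rewrite ler_pM2r//; lra.
have yk' : 0 < y k < eta.
  rewrite yE; apply/andP; split; first by rewrite mulr_gt0//; lra.
  apply: (@le_lt_trans _ _ (2 * H k)); last by lra.
  by rewrite ler_pM2r//; lra.
have := Heta _ _ xk' yk'.
rewrite ler_norml => /andP[w1 w2].
set W := fine _ in w1 w2 *.
move: w1 w2; rewrite xE yE => w1 w2.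
have w1' : - (eps / 8 * (Y - X)) <= W / H k - (rhom * - X + rhop * Y).
  by rewrite -(ler_pM2r Hk) mulrBl divfK ?gt_eqF//; lra.
have w2' : W / H k - (rhom * - X + rhop * Y) <= eps / 8 * (Y - X).
  by rewrite -(ler_pM2r Hk) mulrBl divfK ?gt_eqF//; lra.
have b : eps / 8 * (Y - X) <= eps / 2 by rewrite -mulrA ler_pM2l//; lra.
apply/andP; split; lra.
Unshelve. all: by end_near.
Qed.

End PriorNearZero.

(** * The probability of missing a signal *)

Section NormalMoment.
Context {R : realType}.

(** The integrand times the density of N(0, 1) is at most a multiple of the density
    of N(0, 4), since [exp (3 x ^ 2 / 8)] dominates [1] and [`|x|]. *)
Lemma integrable_affine_abs_normal (a b : R) : 0 <= a -> 0 <= b ->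
  (normal_prob 0 1).-integrable [set: measurableTypeR R] (fun w => (a + b * `|w|)%:E).
Proof.
move=> a0 b0.
have mg : measurable_fun [set: R] (fun w : R => (a + b * `|w|)%:E).
  apply: measurableT_comp => //; apply: measurable_funD => //.
  by apply: measurable_funM => //; exact: measurableT_comp.
have g0 (w : R) : (0 <= (a + b * `|w|)%:E)%E.
  by rewrite lee_fin addr_ge0// mulr_ge0.
apply/integrableP; split; first exact: mg.
under eq_integral do rewrite gee0_abs//.
rewrite ge0_integral_normal_prob//.
have one0 : (1 : R) != 0 := oner_neq0 _.
have two0 : (2 : R) != 0 by rewrite pnatr_eq0.
pose C : R := (a + b) * (normal_peak 1 / normal_peak 2).
have C0 : 0 <= C by rewrite mulr_ge0 ?addr_ge0// divr_ge0 ?normal_peak_ge0.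
apply: (@le_lt_trans _ _ (\int[lebesgue_measure]_x (C%:E * (normal_pdf 0 2 x)%:E))%E).
  apply: ge0_le_integral => //=.
  - by move=> x _; rewrite mule_ge0// lee_fin normal_pdf_ge0.
  - by apply: emeasurable_funM => //; exact: measurable_EFin_normal_pdf.
  - by apply: emeasurable_funM => //; exact: measurable_EFin_normal_pdf.
  move=> x _; rewrite -!EFinM lee_fin !normal_pdfE// /C.
  rewrite -!mulrA mulKf ?gt_eqF ?normal_peak_gt0//.
  rewrite mulrCA [leRHS]mulrCA ler_wpM2l ?normal_peak_ge0//.
  have -> : normal_fun 0 1 x = expR (- (3 / 8 * x ^+ 2)) * normal_fun 0 2 x.
    by rewrite /normal_fun -expRD subr0 expr1n; congr expR; field.
  rewrite mulrA ler_wpM2r ?normal_fun_ge0//.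
  rewrite expRN ler_pdivrMr ?expR_gt0//.
  have e1 : 1 + 3 / 8 * x ^+ 2 <= expR (3 / 8 * x ^+ 2) by exact: expR_ge1Dx.
  have sq : x ^+ 2 = `|x| ^+ 2 by rewrite real_normK ?num_real.
  have e2 : `|x| <= 1 + 3 / 8 * x ^+ 2.
    by rewrite sq; have := sqr_ge0 (`|x| * 3 / 4 - 2 / 3); nra.
  have e3 : 1 <= expR (3 / 8 * x ^+ 2).
    by rewrite -expR0 ler_expR mulr_ge0 ?sqr_ge0//; lra.
  rewrite mulrDl lerD//; first by rewrite ler_peMr.
  by rewrite ler_wpM2l// (le_trans e2).
rewrite ge0_integralZl//=.
- by rewrite integral_normal_pdf mule1 ltry.
- exact: measurable_EFin_normal_pdf.
- by move=> x _; rewrite lee_fin normal_pdf_ge0.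
Qed.

End NormalMoment.

Section Miss.
Context {R : realType}.
Variable nu : probability R R.

(** With [z.1] the standardized noise, [z.2] the true coefficient and [s] the
    noise level, [z.1 + z.2 / s] is the standardized estimate.  The noise has type
    [measurableTypeR R] because this is the type that carries the normal
    measures. *)
Definition miss_set (s u v : R) : set (measurableTypeR R * R) :=
  [set z | - u <= (z.1 : R) + z.2 / s <= v].

Definition miss_prob (s u v : R) : R :=
  fine ((normal_prob 0 1 \x nu) (miss_set s u v))%E.

Lemma measurable_miss_set s u v : measurable (miss_set s u v).
Proof.
rewrite (_ : miss_set _ _ _ =
  (fun z : measurableTypeR R * R => (z.1 : R) + z.2 / s) @^-1` `[- u, v]%classic); last first.
  by apply/seteqP; split => z /=; rewrite in_itv.
rewrite -[X in measurable X]setTI.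
suff : measurable_fun [set: measurableTypeR R * R]
   (fun z : measurableTypeR R * R => (z.1 : R) + z.2 / s) by apply.
apply: measurable_funD; last by apply: measurable_funM.
exact: (@measurable_fst _ _ (measurableTypeR R) R).
Qed.

Lemma xsection_miss_set s u v (w : R) : 0 < s ->
  xsection (miss_set s u v) w = `[s * (- u - w), s * (v - w)]%classic.
Proof.
move=> s0; apply/seteqP; split => x /=; rewrite /xsection /= inE /miss_set /= in_itv/=.
all: have -> : (s * (- u - w) <= x) = (- u - w <= x / s)
  by rewrite ler_pdivlMr// mulrC.
all: have -> : (x <= s * (v - w)) = (x / s <= v - w)
  by rewrite ler_pdivrMr// mulrC.
all: move=> /andP[h1 h2]; apply/andP; split; lra.
Qed.

Lemma fin_num_miss_prob s u v :
  (normal_prob 0 1 \x nu)%E (miss_set s u v) \is a fin_num.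
Proof.
have mE := measurable_miss_set s u v.
exact: (fin_num_measure (product_subprobability
  (normal_prob 0 1 : subprobability (measurableTypeR R) R,
   nu : subprobability R R)) _ mE).
Qed.

Lemma miss_probE s u v :
  (miss_prob s u v)%:E = (\int[normal_prob 0 1]_w nu (xsection (miss_set s u v) w))%E.
Proof. by rewrite /miss_prob fineK// fin_num_miss_prob. Qed.

End Miss.

Section MissAsymptotics.
Context {R : realType}.
Variables (nu : probability R R) (e0 K rhom rhop : R) (rho : R -> R).
Hypothesis nuP : prior_near0 nu e0 K rhom rhop rho.

Let e0_gt0 := prior_radius_gt0 nuP.
Let rho_bounds := prior_density_bounds nuP.

Let K0 := prior_bound_ge0 nuP.

(** If [s * `|w|] is at most [e0 / 2], the window lies where the density is bounded
    by [K], and its length is at most [4 * s * l].  Otherwise [1 / s] is at most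
    [2 / e0 * `|w|], and the bound 1 on the mass is enough. *)
Lemma prior_window_dominated (s l u v w : R) : 0 < s -> 1 <= l ->
  0 <= u <= 2 * l -> 0 <= v <= 2 * l -> s * (2 * l) <= e0 / 2 ->
  fine (nu `[s * (- u - w), s * (v - w)]%classic) / (s * l) <=
  4 * K + 2 / e0 * `|w|.
Proof.
move=> s0 l1 /andP[u0 u2] /andP[v0 v2] sl.
have l0 : 0 < l := lt_le_trans ltr01 l1.
have sl0 : 0 < s * l by rewrite mulr_gt0.
have su : s * u <= e0 / 2 by apply: le_trans sl; rewrite ler_pM2l.
have sv : s * v <= e0 / 2 by apply: le_trans sl; rewrite ler_pM2l.
have [wsmall|wbig] := leP (s * `|w|) (e0 / 2).
  have w0 : 0 <= 2 / e0 * `|w| by rewrite mulr_ge0// divr_ge0// ltW.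
  apply: (@le_trans _ _ (4 * K)); last by rewrite lerDl.
  have sw : - (e0 / 2) <= s * w <= e0 / 2.
    by rewrite -ler_norml normrM (gtr0_norm s0).
  have [sw1 sw2] := andP sw.
  have A_sub : `[s * (- u - w), s * (v - w)]%classic `<=` `[- e0, e0].
    move=> x /=; rewrite !in_itv/= !mulrDr !mulrN => /andP[x1 x2].
    by apply/andP; split; lra.
  have := prior_le nuP (measurable_itv _) A_sub
    (fun x Ax => (andP (rho_bounds (A_sub x Ax))).2).
  rewrite lebesgue_measure_itv/= lte_fin.
  rewrite -(@fineK _ (nu _)) ?fin_num_measure//.
  set W := fine _ => HW.
  rewrite ler_pdivrMr//.
  suff : W <= K * (s * (u + v)).
    move/le_trans; apply.
    rewrite (_ : 4 * K * (s * l) = K * (s * (4 * l))); last by ring.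
    by rewrite ler_wpM2l// ler_pM2l//; lra.
  move: HW; case: ifPn => _; last first.
    rewrite mule0 lee_fin => /le_trans; apply.
    by rewrite mulr_ge0// mulr_ge0 ?addr_ge0// ltW.
  rewrite -EFinB -EFinM lee_fin => /le_trans; apply.
  by apply: ler_wpM2l => //; lra.
apply: (@le_trans _ _ (1 / (s * l))).
  rewrite ler_pM2r ?invr_gt0// -lee_fin fineK ?fin_num_measure//.
  exact: probability_le1.
rewrite -[leLHS]add0r lerD ?mulr_ge0// ler_pdivrMr//.
have -> : 2 / e0 * `|w| * (s * l) = (s * `|w|) / (e0 / 2) * l.
  by field; rewrite gt_eqF.
rewrite -[leLHS]mulr1 ler_pM// ler_pdivlMr ?mul1r ?ltW// divr_gt0//.
Qed.

(** A missed signal is of order [s * l]: at a fixed noise level the window of missed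
    coefficients reaches asymptotically from [- s * l] to [s * l], and the noise is
    integrated out by dominated convergence. *)
Lemma miss_prob_cvg (s l u v : nat -> R) :
  (forall k, 0 < s k) -> s k * l k @[k --> \oo] --> (0 : R) ->
  l @ \oo --> +oo ->
  u k / l k @[k --> \oo] --> (1 : R) -> v k / l k @[k --> \oo] --> (1 : R) ->
  miss_prob nu (s k) (u k) (v k) / (s k * l k) @[k --> \oo] --> rhom + rhop.
Proof.
move=> s0 slcvg loo ucvg vcvg.
have l0 : \forall k \near \oo, 0 < l k by move/cvgryPgt : loo; exact.
have sl0 : \forall k \near \oo, 0 < s k * l k.
  by near=> k; rewrite mulr_gt0//; near: k.
have pointwise (w : R) : fine (nu `[s k * (- u k - w), s k * (v k - w)]%classic)
    / (s k * l k) @[k --> \oo] --> rhom + rhop.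
  have linv : (l k)^-1 @[k --> \oo] --> (0 : R).
    exact/(gtr0_cvgV0 l0).
  apply: (prior_window_cvg nuP sl0 slcvg).
    have : - (u k / l k) - w * (l k)^-1 @[k --> \oo] --> (-1 - w * 0 : R).
      by apply: cvgB; [exact: cvgN|apply: cvgM => //; exact: cvg_cst].
    rewrite mulr0 subr0; apply: cvg_trans; apply: near_eq_cvg.
    near=> k; have lk : l k != 0 by rewrite gt_eqF//; near: k.
    by field; rewrite lk gt_eqF.
  have : v k / l k - w * (l k)^-1 @[k --> \oo] --> (1 - w * 0 : R).
    by apply: cvgB => //; apply: cvgM => //; exact: cvg_cst.
  rewrite mulr0 subr0; apply: cvg_trans; apply: near_eq_cvg.
  near=> k; have lk : l k != 0 by rewrite gt_eqF//; near: k.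
  by field; rewrite lk gt_eqF.
have half0 : 0 < 1 / 2 :> R by lra.
have e4 : 0 < e0 / 4 by rewrite divr_gt0.
have [N _ HN] : \forall k \near \oo, [/\ 1 <= l k, 0 <= u k <= 2 * l k,
    0 <= v k <= 2 * l k & s k * (2 * l k) <= e0 / 2].
  near=> k.
  have lk : 1 <= l k by near: k; move/cvgryPge : loo; exact.
  have lk0 : 0 < l k by apply: lt_le_trans lk.
  have uk : `|1 - u k / l k| <= 1 / 2.
    by near: k; move/cvgrPdist_le : ucvg => /(_ _ half0).
  have vk : `|1 - v k / l k| <= 1 / 2.
    by near: k; move/cvgrPdist_le : vcvg => /(_ _ half0).
  have slk : `|0 - s k * l k| <= e0 / 4.
    by near: k; move/cvgrPdist_le : slcvg => /(_ _ e4).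
  have ratio (x : R) : `|1 - x / l k| <= 1 / 2 -> 0 <= x <= 2 * l k.
    have lkN : l k != 0 by rewrite gt_eqF.
    rewrite ler_norml => h; have xE : x = x / l k * l k by rewrite divfK.
    have r0 : 0 <= x / l k <= 2 by apply/andP; split; lra.
    have [r1 r2] := andP r0.
    by rewrite xE ler_pM2r // r2 andbT mulr_ge0 // ltW.
  split => //; [exact: ratio|exact: ratio|].
  move: slk; rewrite sub0r normrN ler_norml => /andP[_ h].
  by rewrite mulrCA; lra.
(* the domination only holds from N on, hence the zero functions before *)
pose f_ k (w : measurableTypeR R) : \bar R := if (N <= k)%N then
  (nu (xsection (miss_set (s k) (u k) (v k)) w) * ((s k * l k)^-1)%:E)%E else 0%E.
pose g (w : measurableTypeR R) := (4 * K + 2 / e0 * `|w : R|)%:E.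
have mf_ k : measurable_fun [set: measurableTypeR R] (f_ k).
  rewrite /f_; case: (N <= k)%N => //; apply: emeasurable_funM => //.
  by apply: measurable_fun_xsection; exact: measurable_miss_set.
have ig : (normal_prob 0 1).-integrable [set: measurableTypeR R] g.
  by apply: integrable_affine_abs_normal; rewrite ?mulr_ge0// invr_ge0 ltW.
have f_E k w : (N <= k)%N -> f_ k w =
    (fine (nu `[s k * (- u k - w), s k * (v k - w)]%classic) / (s k * l k))%:E.
  move=> Nk; rewrite /f_ Nk xsection_miss_set// EFinM fineK//.
  by rewrite fin_num_measure.
have f_cvg (w : measurableTypeR R) : f_ k w @[k --> \oo] --> (rhom + rhop)%:E.
  have h := pointwise w.
  have : (EFin \o (fun k => fine (nu `[s k * (- u k - (w : R)), s k * (v k - (w : R))]%classic)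
    / (s k * l k))) k @[k --> \oo] --> (rhom + rhop)%:E.
    by apply: cvg_EFin h; exact: nearW.
  apply: cvg_trans; apply: near_eq_cvg; exists N => // k /= Nk.
  by rewrite f_E.
have f_g k (w : measurableTypeR R) : (`|f_ k w| <= g w)%E.
  have [Nk|kN] := leqP N k; last first.
    rewrite /f_ leqNgt kN/= normr0 lee_fin addr_ge0 ?mulr_ge0 ?invr_ge0//.
    by rewrite ltW.
  have [lk uk vk slk] := HN k Nk.
  rewrite f_E// gee0_abs.
    by rewrite lee_fin; exact: prior_window_dominated.
  rewrite lee_fin divr_ge0 ?fine_ge0// mulr_ge0 ?ltW// (lt_le_trans _ lk)//.
have [_ _ dom] := dominated_convergence measurableT mf_
  (measurable_cst (rhom + rhop)%:E)
  (aeW _ (fun w _ => f_cvg w)) ig (aeW _ (fun w n _ => f_g n w)).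
have : fine (\int[normal_prob 0 1]_x f_ k x)%E @[k --> \oo] --> rhom + rhop.
  apply: fine_cvg; move: dom; rewrite integral_cst//=.
  by rewrite probability_setT mule1.
apply: cvg_trans; apply: near_eq_cvg; exists N => // k /= Nk.
have [lk _ _ _] := HN k Nk.
rewrite -[RHS]/(fine (_ / _)%:E) EFinM miss_probE; congr fine.
rewrite /f_ Nk ge0_integralZr//.
- by apply: measurable_fun_xsection; exact: measurable_miss_set.
- by rewrite lee_fin invr_ge0 mulr_ge0 ?ltW// (lt_le_trans _ lk).
Unshelve. all: by end_near.
Qed.

End MissAsymptotics.

(** * Risk of a threshold rule *)

Section ExpectedCardinal.
Context {R : realType} {d : measure_display} {T : measurableType d}.
Variable P : probability T R.

Variables (I : finType) (S : T -> {set I}).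
Hypothesis mS : forall i, measurable [set w | i \in S w].

Let card_indic w : #|S w|%:R = \sum_i \1_[set w | i \in S w] w :> R.
Proof.
rewrite -sum1_card natr_sum big_mkcond/=.
apply: eq_bigr => i _; rewrite indicE; case: ifPn => iS.
  by rewrite mem_set.
by rewrite memNset//; exact/negP.
Qed.

Lemma measurable_card : measurable_fun [set: T] (fun w => #|S w|%:R : R).
Proof.
under eq_fun do rewrite card_indic.
by apply: measurable_sum => i; exact: measurable_indic.
Qed.

Lemma expectation_card :
  ('E_P[fun w => #|S w|%:R] = \sum_i P [set w | i \in S w])%E.
Proof.
rewrite unlock.
under eq_integral do rewrite card_indic -sumEFin.
rewrite ge0_integral_sum//; last first.
  by move=> i; apply: measurableT_comp => //; exact: measurable_indic.
by apply: eq_bigr => i _; rewrite integral_indic// setIT.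
Qed.

End ExpectedCardinal.

Section ThresholdRule.
Context {R : realType} {d : measure_display} {T : measurableType d}.
Variable P : probability T R.
Context {n m : nat}.
Variables (X : 'M[R]_(n, m.+1)) (b0 : R).
Variables (beta : 'I_m -> {RV P >-> R}) (eps : 'I_n -> {RV P >-> R}).
Variables (sigma p : R) (nu : probability R R).
Hypotheses (n_gt0 : (0 < n)%N) (X_orth : orthogonal_design X).
Hypotheses (sigma_gt0 : 0 < sigma) (p_itv : 0 < p < 1).
Hypothesis nu_zero : nu [set 0] = 0%E.
Hypothesis model : sparse_model beta eps sigma p nu.

Let s : R := sigma / Num.sqrt n%:R.

Let s_gt0 : 0 < s.
Proof. by rewrite divr_gt0// sqrtr_gt0 ltr0n. Qed.

(** Nothing is required at the cutoffs themselves, so that the definition covers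
    every way of breaking ties. *)
Definition threshold_rule (rule : 'cV[R]_n -> {set 'I_m}) (u v : R) : Prop :=
  forall Y i, (i \in rule Y -> lse X Y i / s <= - u \/ v <= lse X Y i / s) /\
              (i \notin rule Y -> - u <= lse X Y i / s <= v).

Variables (rule : 'cV[R]_n -> {set 'I_m}) (u v : R).
Hypothesis rule_uv : threshold_rule rule u v.
Hypothesis rule_meas : measurable_rule X b0 beta eps rule.

Let resp := response X b0 beta eps.
Let truth := true_model beta.

Let lse_std i w : lse X (resp w) i / s = noise X eps sigma i w + beta i w / s.
Proof.
rewrite /resp (lse_response _ _ _ n_gt0 X_orth sigma_gt0) -/s; field.
by rewrite gt_eqF.
Qed.

Lemma measurable_truth i : measurable [set w | i \in truth w].
Proof.
rewrite (_ : [set w | _] = beta i @^-1` (~` [set 0])).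
  by rewrite -[X in measurable X]setTI; apply: measurable_funP => //; exact: measurableC.
by apply/seteqP; split => w /=; rewrite inE => /eqP.
Qed.

Lemma measurable_false_positive i :
  measurable [set w | i \in (rule (resp w) :\: truth w)%SET].
Proof.
rewrite (_ : [set w | _] = [set w | i \in rule (resp w)] `\` [set w | i \in truth w]).
  by apply: measurableD; [exact: rule_meas|exact: measurable_truth].
apply/seteqP; split => w /=; rewrite finset.in_setD.
  by move=> /andP[/negP h1 h2].
by move=> [-> /negP ->].
Qed.

Lemma measurable_false_negative i :
  measurable [set w | i \in (truth w :\: rule (resp w))%SET].
Proof.
rewrite (_ : [set w | _] = [set w | i \in truth w] `\` [set w | i \in rule (resp w)]).
  by apply: measurableD; [exact: measurable_truth|exact: rule_meas].
apply/seteqP; split => w /=; rewrite finset.in_setD.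
  by move=> /andP[/negP h1 h2].
by move=> [-> /negP ->].
Qed.

Lemma false_positive_le i : 0 <= u -> 0 <= v ->
  (P [set w | i \in (rule (resp w) :\: truth w)%SET] <=
  ((1 - p) * (expR (- (u ^+ 2 / 2)) + expR (- (v ^+ 2 / 2))))%:E)%E.
Proof.
move=> u0 v0.
pose A : set R := `]-oo, - u]%classic `|` `[v, +oo[%classic.
have mA : measurable A by apply: measurableU; exact: measurable_itv.
have mnoise : measurable (noise X eps sigma i @^-1` A).
  by rewrite -[X in measurable X]setTI; exact: (measurable_noise X eps sigma i).
have mbeta0 : measurable (beta i @^-1` [set 0]).
  by rewrite -[X in measurable X]setTI; exact: (measurable_funP (beta i)).
apply: (@le_trans _ _ (P (noise X eps sigma i @^-1` A `&` beta i @^-1` [set 0]))).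
  apply: le_measure; rewrite ?inE.
  - exact: measurable_false_positive.
  - exact: measurableI.
  move=> w /=; rewrite finset.in_setD inE negbK => /andP[/eqP bw iw].
  split => //; have := (rule_uv (resp w) i).1 iw.
  rewrite lse_std bw mul0r addr0 /A /= !in_itv/= andbT.
  by case; [left|right].
rewrite (prob_noise_coef0 n_gt0 X_orth sigma_gt0 nu_zero model)// muleC EFinM.
apply: lee_wpmul2l; first by rewrite lee_fin subr_ge0; case/andP: p_itv => _ /ltW.
rewrite EFinD; apply: le_trans (measureU2 _ _ _) _; [exact: measurable_itv..|].
by apply: leeD; [exact: normal_prob_left_tail|exact: normal_prob_right_tail].
Qed.

Let mpair i (E : set (measurableTypeR R * R)) : measurable E ->
  measurable ((fun w => (noise X eps sigma i w : measurableTypeR R, beta i w)) @^-1` E).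
Proof.
move=> mE; rewrite -[X in measurable X]setTI.
have : measurable_fun [set: T]
    (fun w => (noise X eps sigma i w : measurableTypeR R, beta i w)).
  by apply: measurable_fun_pair; [exact: measurable_noise|exact: (measurable_funP (beta i))].
exact.
Qed.

Let mneq0 i : measurable [set w | beta i w != 0].
Proof.
rewrite (_ : [set w | _] = [set w | i \in truth w]); first exact: measurable_truth.
by apply/seteqP; split => w /=; rewrite inE.
Qed.

Lemma false_negative_le i :
  (P [set w | i \in (truth w :\: rule (resp w))%SET] <= (p * miss_prob nu s u v)%:E)%E.
Proof.
have mE := measurable_miss_set s u v.
apply: (@le_trans _ _ (P ((fun w => (noise X eps sigma i w, beta i w)) @^-1` miss_set s u v
    `&` [set w | beta i w != 0]))).
  apply: le_measure; rewrite ?inE.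
  - exact: measurable_false_negative.
  - by apply: measurableI => //; exact: mpair.
  move=> w /=; rewrite finset.in_setD inE => /andP[iw bw]; split => //.
  by rewrite /miss_set /= -lse_std; exact: (rule_uv (resp w) i).2.
rewrite (prob_noise_coef_neq0 n_gt0 X_orth sigma_gt0 p_itv nu_zero model)//.
by rewrite muleC EFinM /miss_prob fineK// fin_num_miss_prob.
Qed.

Lemma false_negative_ge i :
  ((p * miss_prob nu s (u - 1) (v - 1))%:E <=
   P [set w | i \in (truth w :\: rule (resp w))%SET])%E.
Proof.
have mE := measurable_miss_set s (u - 1) (v - 1).
apply: (@le_trans _ _ (P ((fun w => (noise X eps sigma i w, beta i w)) @^-1`
    miss_set s (u - 1) (v - 1) `&` [set w | beta i w != 0]))).
  rewrite (prob_noise_coef_neq0 n_gt0 X_orth sigma_gt0 p_itv nu_zero model)//.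
  by rewrite [leRHS]muleC EFinM /miss_prob fineK// fin_num_miss_prob.
apply: le_measure; rewrite ?inE.
- by apply: measurableI => //; exact: mpair.
- exact: measurable_false_negative.
move=> w /= [+ bw]; rewrite finset.in_setD inE bw andbT /miss_set /= -lse_std => /andP[h1 h2].
by apply/negP => /(rule_uv (resp w) i).1 [h|h]; lra.
Qed.

Variables (delta0 deltaA : R).
Hypotheses (delta0_ge0 : 0 <= delta0) (deltaA_ge0 : 0 <= deltaA).

Let riskE : risk X b0 beta eps delta0 deltaA rule =
  (delta0%:E * \sum_i P [set w | i \in (rule (resp w) :\: truth w)%SET] +
   deltaA%:E * \sum_i P [set w | i \in (truth w :\: rule (resp w))%SET])%E.
Proof.
rewrite /risk !expectation_card//.
- by move=> i; exact: measurable_false_negative.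
- by move=> i; exact: measurable_false_positive.
Qed.

Lemma risk_le : 0 <= u -> 0 <= v ->
  (risk X b0 beta eps delta0 deltaA rule <=
   (m%:R * (delta0 * ((1 - p) * (expR (- (u ^+ 2 / 2)) + expR (- (v ^+ 2 / 2))))
          + deltaA * (p * miss_prob nu s u v)))%:E)%E.
Proof.
move=> u0 v0; rewrite riskE.
have sumle (f : 'I_m -> \bar R) (x : R) : (forall i, f i <= x%:E)%E ->
    (\sum_i f i <= (m%:R * x)%:E)%E.
  move=> fx; apply: (@le_trans _ _ (\sum_(i < m) x%:E)%E).
    by apply: lee_sum => i _; exact: fx.
  by rewrite sumEFin sumr_const card_ord mulr_natl.
rewrite mulrDr EFinD; apply: leeD.
  rewrite mulrCA EFinM; apply: lee_wpmul2l; first by rewrite lee_fin.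
  by apply: sumle => i; exact: false_positive_le.
rewrite mulrCA EFinM; apply: lee_wpmul2l; first by rewrite lee_fin.
by apply: sumle => i; exact: false_negative_le.
Qed.

(** Lowering both cutoffs by one puts the estimate strictly between the actual
    cutoffs, where the rule does not select however ties are broken. *)
Lemma risk_ge :
  ((m%:R * (deltaA * (p * miss_prob nu s (u - 1) (v - 1))))%:E <=
   risk X b0 beta eps delta0 deltaA rule)%E.
Proof.
rewrite riskE -[leLHS]add0e; apply: leeD.
  by rewrite mule_ge0// ?lee_fin// sume_ge0.
rewrite mulrCA EFinM; apply: lee_wpmul2l; first by rewrite lee_fin.
apply: (@le_trans _ _ (\sum_(i < m) (p * miss_prob nu s (u - 1) (v - 1))%:E)%E).
  by rewrite sumEFin sumr_const card_ord mulr_natl.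
by apply: lee_sum => i _; exact: false_negative_ge.
Qed.

Lemma measurable_correct : measurable [set w | rule (resp w) = truth w].
Proof.
rewrite (_ : [set w | _] = ~` (\bigcup_(i in [set: 'I_m])
   ([set w | i \in (rule (resp w) :\: truth w)%SET] `|`
    [set w | i \in (truth w :\: rule (resp w))%SET]))).
  apply: measurableC; apply: fin_bigcup_measurable => //.
  by move=> i _; apply: measurableU;
    [exact: measurable_false_positive|exact: measurable_false_negative].
apply/seteqP; split => w /=.
  by move=> e [i _ /=]; rewrite e finset.setDv inE; case.
move=> h; apply/setP => i; apply/idP/idP => iw; apply/negPn/negP => iN; apply: h.
  by exists i => //; left; rewrite /= finset.in_setD iN.
by exists i => //; right; rewrite /= finset.in_setD iN.
Qed.

(** An incorrect selection makes at least one error, and with unit losses the risk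
    is the expected number of errors. *)
Lemma prob_incorrect_le_risk :
  (P (~` [set w | rule (resp w) = truth w]) <= risk X b0 beta eps 1 1 rule)%E.
Proof.
have mfp : measurable_fun [set: T] (fun w => #|(rule (resp w) :\: truth w)%SET|%:R : R).
  by apply: measurable_card => i; exact: measurable_false_positive.
have mfn : measurable_fun [set: T] (fun w => #|(truth w :\: rule (resp w))%SET|%:R : R).
  by apply: measurable_card => i; exact: measurable_false_negative.
have mfpE := measurableT_comp (@EFin_measurable _ setT) mfp.
have mfnE := measurableT_comp (@EFin_measurable _ setT) mfn.
have mC := measurableC measurable_correct.
rewrite /risk !mul1e unlock -ge0_integralD//=.
rewrite -(setIT (~` _)) -integral_indic//.
apply: ge0_le_integral => //=.
- by apply: measurableT_comp => //; exact: measurable_indic.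
- exact: emeasurable_funD.
move=> w _; rewrite -EFinD lee_fin indicE.
have [e|ne] := eqVneq (rule (resp w)) (truth w).
  by rewrite memNset ?addr_ge0// /=; apply: contra_not; apply.
rewrite mem_set /=; last exact/eqP.
rewrite -natrD ler1n addn_gt0 !card_gt0 -negb_and.
by apply: contra ne; rewrite !finset.setD_eq0 finset.eqEsubset.
Qed.

End ThresholdRule.

(** * The mean likelihood ratio *)

Section LikelihoodRatio.
Context {R : realType}.
Variable nu : probability R R.
Implicit Types s a b c q t x y : R.

(** The likelihood ratio, averaged over the prior, between a signal and no signal
    when the estimate is [a] and its standard deviation is [s]. *)
Definition mean_lr s a : R :=
  (\int[nu]_t expR ((a * t - t ^+ 2 / 2) / s ^+ 2))%R.

Let lr s a t := expR ((a * t - t ^+ 2 / 2) / s ^+ 2).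

Lemma lrE s a t : s != 0 ->
  lr s a t = expR ((a / s) ^+ 2 / 2) * expR (- ((t - a) ^+ 2 / (s ^+ 2 *+ 2))).
Proof. by move=> s0; rewrite /lr -expRD; congr expR; field. Qed.

Lemma lr_le s a t : s != 0 -> lr s a t <= expR ((a / s) ^+ 2 / 2).
Proof.
move=> s0; rewrite lrE// ler_piMr ?expR_ge0// -expR0 ler_expR oppr_le0.
by rewrite divr_ge0 ?sqr_ge0// mulrn_wge0 ?sqr_ge0.
Qed.

Lemma measurable_lr s a : measurable_fun [set: R] (lr s a).
Proof.
apply: measurableT_comp => //; apply: measurable_funM => //.
apply: measurable_funB; first exact: measurable_funM.
by apply: measurable_funM => //; exact: measurable_funX.
Qed.

Let measurable_EFin_lr s a : measurable_fun [set: R] (fun t => (lr s a t)%:E).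
Proof. by apply: measurableT_comp => //; exact: measurable_lr. Qed.

Lemma integrable_lr s a : s != 0 -> nu.-integrable [set: R] (EFin \o lr s a).
Proof.
move=> s0.
apply: (@le_integrable _ _ _ nu setT measurableT _
  (EFin \o cst (expR ((a / s) ^+ 2 / 2)))).
- exact: measurable_EFin_lr.
- by move=> t _ /=; rewrite lee_fin !ger0_norm ?expR_ge0//; exact: lr_le.
- exact: finite_measure_integrable_cst.
Qed.

Lemma mean_lrE s a : s != 0 -> (mean_lr s a)%:E = (\int[nu]_t (lr s a t)%:E)%E.
Proof.
move=> s0; rewrite /mean_lr /Rintegral fineK//.
exact: integrable_fin_num (integrable_lr _ s0).
Qed.

Lemma mean_lr_ge s a c (S : set R) : s != 0 -> 0 <= c -> measurable S ->
  (forall t, S t -> c <= lr s a t) -> c * fine (nu S) <= mean_lr s a.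
Proof.
move=> s0 c0 mS Sc; rewrite -lee_fin mean_lrE// EFinM fineK ?fin_num_measure//.
rewrite -integral_cst//.
apply: (@le_trans _ _ (\int[nu]_(t in S) (lr s a t)%:E)%E).
  apply: ge0_le_integral => //=.
  by apply: measurable_funTS; exact: measurable_EFin_lr.
apply: ge0_subset_integral => //.
by move=> t _; rewrite lee_fin expR_ge0.
Qed.

Lemma mean_lr0_le1 s : s != 0 -> mean_lr s 0 <= 1.
Proof.
move=> s0; rewrite -lee_fin mean_lrE//.
apply: (@le_trans _ _ (\int[nu]_t (1%R)%:E)%E); last first.
  by rewrite integral_cst// mul1e; exact: probability_le1.
apply: ge0_le_integral => //=.
- by move=> t _; rewrite lee_fin expR_ge0.
by move=> t _; rewrite lee_fin; have := @lr_le s 0 t s0; rewrite mul0r expr0n mul0r expR0.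
Qed.

Lemma continuous_mean_lr s : s != 0 -> continuous (mean_lr s).
Proof.
move=> s0 a.
pose A := `|a| + 1.
have aA : a \in `]- A, A[%classic.
  rewrite inE/= in_itv/= -ltr_norml /A; lra.
apply: (@continuity_under_integral R _ _ nu (lr s) setT measurableT (- A) A
  _ _ (cst (expR ((A / s) ^+ 2 / 2))) _ _ a aA).
- by move=> x _; exact: integrable_lr.
- apply: aeW => t _ x _; apply: continuous_comp; last exact: continuous_expR.
  apply: cvgM; last exact: cvg_cst.
  by apply: cvgB; [apply: cvgM; [exact: cvg_id|exact: cvg_cst]|exact: cvg_cst].
- exact: finite_measure_integrable_cst.
- move=> x; rewrite /= in_itv/= -ltr_norml => xA; apply: aeW => t _.
  rewrite ger0_norm ?expR_ge0//; apply: le_trans (lr_le _ _ s0) _.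
  rewrite ler_expR ler_pM2r//.
  rewrite -(real_normK (num_real (x / s))) -(real_normK (num_real (A / s))).
  rewrite ler_sqr ?nnegrE// !normrM ler_wpM2r// ler_normr.
  by rewrite (ltW xA).
Qed.

Section Density.
Variables (e0 K rhom rhop : R) (rho : R -> R).
Local Notation mu := (@lebesgue_measure R).
Hypothesis nuP : prior_near0 nu e0 K rhom rhop rho.

Let e0_gt0 := prior_radius_gt0 nuP.
Let rho_bounds := prior_density_bounds nuP.
Let rhom_gt0 := prior_density_left_gt0 nuP.
Let rhop_gt0 := prior_density_right_gt0 nuP.

Let K0 := prior_bound_ge0 nuP.

Let D : set R := `[- e0, e0]%classic.
Let mD : measurable D. Proof. exact: measurable_itv. Qed.

(** On [D] the prior is at most [K] times Lebesgue measure as a measure, hence also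
    for integrals of nonnegative functions. *)
Lemma prior_integral_le (f : R -> \bar R) :
  measurable_fun [set: R] f -> (forall x, 0 <= f x)%E ->
  (\int[nu]_(x in D) f x <= K%:E * \int[mu]_x f x)%E.
Proof.
move=> mf f0.
pose k : {nonneg R} := NngNum K0.
pose nuD : {measure set R -> \bar R} := mrestr nu mD.
(* Lebesgue measure lives on [measurableTypeR R]; transport it to [R] *)
pose idR (x : measurableTypeR R) : R := x.
have midR : measurable_fun [set: measurableTypeR R] idR.
  by move=> _ Y mY; rewrite setTI.
pose muK : {measure set R -> \bar R} := mscale k (pushforward mu idR).
have nuD_le S : measurable S -> (nuD S <= muK midR S)%E.
  move=> mS; rewrite /nuD /muK /mrestr/= /mscale/=.
  have SD : S `&` D `<=` D by move=> ? [].
  apply: (@le_trans _ _ (K%:E * mu (S `&` D))%E).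
    apply: (prior_le nuP) => //; first exact: measurableI.
    by move=> x /SD /rho_bounds /andP[].
  apply: lee_wpmul2l; first by rewrite lee_fin.
  by apply: le_measure; rewrite ?inE//; exact: measurableI.
apply: (@le_trans _ _ (\int[muK midR]_(x in D) f x)%E).
  rewrite (@eq_measure_integral _ _ _ _ nuD nu); last first.
    by move=> A mA AD; rewrite /nuD/= /mrestr setIidl.
  exact: ge0_le_measure_integral.
rewrite ge0_integral_mscale//; last exact: measurable_funTS.
rewrite ge0_integral_pushforward//; last exact: measurable_funTS.
apply: lee_wpmul2l; first by rewrite lee_fin.
exact: ge0_subset_integral.
Qed.

Definition lr_bound : R := K / normal_peak 1 + 8 / e0 ^+ 2.

(** After completing the square, the part of the integral within [e0] of zero is at
    most a full Gaussian integral, of order [s].  Elsewhere the integrand is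
    exponentially small in [s ^- 2]; the bound [y <= exp y] suffices to make this
    part of order [s] too. *)
Lemma mean_lr_le s a : 0 < s <= 1 -> `|a| <= e0 / 2 ->
  mean_lr s a <= expR ((a / s) ^+ 2 / 2) * (lr_bound * s).
Proof.
move=> /andP[s0 s1] ae.
have sN : s != 0 by rewrite gt_eqF.
rewrite -lee_fin mean_lrE//.
have mgE (D' : set R) : measurable_fun D' (fun t => (normal_fun a s t)%:E).
  by apply: measurable_funTS; apply: measurableT_comp => //; exact: measurable_normal_fun.
have gE t : expR (- ((t - a) ^+ 2 / (s ^+ 2 *+ 2))) = normal_fun a s t.
  by rewrite /normal_fun mulNr.
under eq_integral do rewrite lrE// EFinM gE.
rewrite ge0_integralZl//=; last by move=> t _; rewrite lee_fin normal_fun_ge0.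
rewrite [leRHS]EFinM; apply: lee_wpmul2l; first by rewrite lee_fin expR_ge0.
have peakE : normal_peak s = normal_peak 1 / s.
  have sE : s = Num.sqrt (s ^+ 2) by rewrite sqrtr_sqr gtr0_norm.
  rewrite /normal_peak -invfM [X in _ = (_ * X)^-1]sE -sqrtrM.
    by congr (Num.sqrt _)^-1; ring.
  by rewrite expr1n mul1r mulrn_wge0// pi_ge0.
have peak1 : 0 < normal_peak 1 :> R by rewrite normal_peak_gt0// oner_neq0.
rewrite -(setvU D) ge0_integral_setU//=; last 3 first.
- exact: measurableC.
- by move=> t _; rewrite lee_fin normal_fun_ge0.
- by apply/disj_setPS => t [].
rewrite /lr_bound mulrDl (addrC (_ * s)) EFinD; apply: leeD.
  apply: (@le_trans _ _ (\int[nu]_(t in ~` D) (8 / e0 ^+ 2 * s)%:E)%E).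
    apply: ge0_le_integral => //=.
    - exact: measurableC.
    - by move=> t _; rewrite lee_fin normal_fun_ge0.
    move=> t tD; have /negP : ~ (t \in `[- e0, e0]) := tD.
    rewrite in_itv/= -ler_norml -ltNge => te.
    rewrite lee_fin /normal_fun.
    have ta : (e0 / 2) ^+ 2 <= (t - a) ^+ 2.
      rewrite -[leRHS](real_normK (num_real _)) ler_sqr ?nnegrE// ?divr_ge0 ?ltW//.
      by have := ler_normD (t - a) a; rewrite subrK; lra.
    set y := (t - a) ^+ 2 / (s ^+ 2 *+ 2).
    have y0 : e0 ^+ 2 / (8 * s ^+ 2) <= y.
      rewrite /y ler_pdivlMr ?pmulrn_lgt0 ?exprn_gt0//.
      suff -> : e0 ^+ 2 / (8 * s ^+ 2) * (s ^+ 2 *+ 2) = (e0 / 2) ^+ 2 by [].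
      by rewrite -mulr_natr; field.
    have y1 : 0 < e0 ^+ 2 / (8 * s ^+ 2) by rewrite divr_gt0 ?mulr_gt0 ?exprn_gt0.
    rewrite mulNr -/y expRN.
    apply: (@le_trans _ _ (8 * s ^+ 2 / e0 ^+ 2)).
      rewrite -[leRHS]invrK lef_pV2 ?posrE ?expR_gt0//; last first.
        by rewrite invr_gt0 divr_gt0 ?mulr_gt0 ?exprn_gt0.
      rewrite invf_div; apply: le_trans y0 _.
      by apply: le_trans (expR_ge1Dx y); lra.
    rewrite (_ : 8 * s ^+ 2 / e0 ^+ 2 = 8 / e0 ^+ 2 * s * s); last by ring.
    by rewrite ler_piMr// mulr_ge0 ?divr_ge0 ?sqr_ge0// ltW.
  rewrite integral_cst//; last exact: measurableC.
  rewrite -[leRHS]mule1; apply: lee_wpmul2l.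
    by rewrite lee_fin mulr_ge0 ?divr_ge0 ?sqr_ge0// ltW.
  exact: probability_le1 (measurableC mD).
apply: le_trans (prior_integral_le _ _) _ => //.
  by move=> t; rewrite lee_fin normal_fun_ge0.
have -> : (\int[mu]_t (normal_fun a s t)%:E = ((normal_peak s)^-1)%:E)%E.
  have := integral_normal_pdf a s.
  rewrite normal_pdfE//.
  under eq_integral do rewrite EFinM.
  rewrite ge0_integralZl//=; last 2 first.
  - by move=> t _; rewrite lee_fin normal_fun_ge0.
  - by rewrite lee_fin normal_peak_ge0.
    move=> h.
    by rewrite -[RHS]mule1 -h muleA -EFinM mulVf ?mul1e// gt_eqF// normal_peak_gt0.
  exact: (mgE setT).
by rewrite -EFinM lee_fin peakE invf_div mulrCA mulrC.
Qed.

(** The sign [e] selects the side of zero, so that both roots of the oracle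
    equation can be treated together. *)
Lemma prior_side_window e : e = 1 \/ e = -1 ->
  exists eta kappa : R, [/\ 0 < eta, 0 < kappa &
    forall x y, 0 < x < y -> y < eta ->
      kappa * (y - x) <= fine (nu [set t | x <= e * t <= y])].
Proof.
case=> ->.
  have r2 : 0 < rhop / 2 by rewrite divr_gt0.
  have [eta eta0 H] := prior_right_window nuP r2.
  exists eta, (rhop / 2); split => // x y /andP[x0 xy] ye.
  have -> : [set t : R | x <= 1 * t <= y] = `[x, y]%classic.
    by apply/seteqP; split => t; rewrite /= in_itv/= mul1r.
  have S : `[x, y]%classic `<=` `]0, eta[.
    move=> t /=; rewrite !in_itv/= => /andP[xt ty].
    by rewrite (lt_le_trans x0 xt) (le_lt_trans ty ye).
  have /andP[+ _] := H _ (measurable_itv _) S.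
  rewrite lebesgue_measure_itv/= lte_fin xy -EFinB -EFinM.
  rewrite -(@fineK _ (nu _)) ?fin_num_measure// lee_fin; apply: le_trans.
  by rewrite ler_pM2r ?subr_gt0//; lra.
have r2 : 0 < rhom / 2 by rewrite divr_gt0.
have [eta eta0 H] := prior_left_window nuP r2.
exists eta, (rhom / 2); split => // x y /andP[x0 xy] ye.
have -> : [set t : R | x <= -1 * t <= y] = `[- y, - x]%classic.
  by apply/seteqP; split => t; rewrite /= in_itv/= mulN1r lerNr lerNl andbC.
have S : `[- y, - x]%classic `<=` `]- eta, 0[.
  by move=> t /=; rewrite !in_itv/= => /andP[xt ty]; apply/andP; split; lra.
have /andP[+ _] := H _ (measurable_itv _) S.
rewrite lebesgue_measure_itv/= lte_fin ltrN2 xy -EFinB -EFinM.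
rewrite -(@fineK _ (nu _)) ?fin_num_measure// lee_fin; apply: le_trans.
by rewrite opprK (addrC (- x)) ler_pM2r ?subr_gt0//; lra.
Qed.

End Density.
End LikelihoodRatio.

(** * Roots of the oracle equation *)

Section LikelihoodRatioRoot.
Context {R : realType}.
Variables (nu : probability R R) (e0 K rhom rhop : R) (rho : R -> R).
Hypothesis nuP : prior_near0 nu e0 K rhom rhop rho.

Let e0_gt0 := prior_radius_gt0 nuP.

Variables (s q : nat -> R) (Q e : R).
Hypothesis s_gt0 : forall k, 0 < s k.
Hypothesis s_cvg : s @ \oo --> (0 : R).
Hypothesis q_ge2 : \forall k \near \oo, 2 <= q k.
Hypothesis Q_gt0 : 0 < Q.
Hypothesis q_le : \forall k \near \oo, q k * s k ^+ 2 <= Q.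
Hypothesis e_sign : e = 1 \/ e = -1.

Let e2 : e ^+ 2 = 1. Proof. by case: e_sign => ->; ring. Qed.

Let s_small (x : R) : 0 < x -> \forall k \near \oo, s k < x.
Proof.
move=> x0; move/cvgrPdist_lt : s_cvg => /(_ _ x0); apply: filterS => k.
by rewrite sub0r normrN gtr0_norm.
Qed.

Let msign (x y : R) : measurable [set t | x <= e * t <= y].
Proof.
rewrite (_ : [set t | _] = (fun t => e * t) @^-1` `[x, y]%classic); last first.
  by apply/seteqP; split => t; rewrite /= in_itv.
rewrite -[X in measurable X]setTI.
suff : measurable_fun [set: R] (fun t => e * t) by apply.
exact: measurable_funM.
Qed.

Let lr_sign sk b t : (e * b * t - t ^+ 2 / 2) / sk ^+ 2 =
  (b * (e * t) - (e * t) ^+ 2 / 2) / sk ^+ 2.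
Proof. by rewrite exprMn e2 mul1r (mulrC e b) mulrA. Qed.

(** The signals with [eta' / 2 <= e * t <= eta'] alone contribute a multiple of
    [exp (3 / 8 * (eta' / s) ^ 2)], which exceeds any multiple of [s ^- 2]. *)
Lemma mean_lr_large (eta : R) : 0 < eta -> \forall k \near \oo, forall b, eta <= b ->
  q k < mean_lr nu (s k) (e * b).
Proof.
move=> eta00.
have [eta1 [kappa [eta10 kappa0 H]]] := prior_side_window nuP e_sign.
pose eta' := Num.min eta (eta1 / 2).
have eta'0 : 0 < eta' by rewrite lt_min eta00 divr_gt0.
have eta'eta : eta' <= eta by rewrite ge_min lexx.
have eta'1 : eta' < eta1.
  apply: (@le_lt_trans _ _ (eta1 / 2)); first by rewrite ge_min lexx orbT.
  by lra.
(* 9 / 256 comes from [expR y >= y ^ 2 / 4] with y = 3 / 8 * (eta' / s) ^ 2 *)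
pose c1 := kappa * (eta' / 2) * (9 / 256 * eta' ^+ 4).
have c10 : 0 < c1 by rewrite !mulr_gt0 ?exprn_gt0// ?divr_gt0//; lra.
have cQ : 0 < c1 / Q by rewrite divr_gt0.
near=> k => b be.
have sk0 := s_gt0 k.
have sk1 : s k < 1 by near: k; exact: s_small.
have skc : s k < c1 / Q by near: k; exact: s_small.
have qk : q k * s k ^+ 2 <= Q by near: k.
have sN : s k != 0 by rewrite gt_eqF.
pose S : set R := [set t | eta' / 2 <= e * t <= eta'].
pose y := 3 / 8 * eta' ^+ 2 / s k ^+ 2.
have h1 : expR y * fine (nu S) <= mean_lr nu (s k) (e * b).
  apply: mean_lr_ge => //; [exact: msign|].
  move=> t /= /andP[t1 t2]; rewrite ler_expR lr_sign /y ler_pM2r ?invr_gt0 ?exprn_gt0//.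
  have : eta' * (e * t) <= b * (e * t).
    by apply: ler_wpM2r; [apply: le_trans t1; rewrite divr_ge0 ?ltW|apply: le_trans be].
  have : 0 <= (e * t - eta' / 2) * (3 / 2 * eta' - e * t).
    by apply: mulr_ge0; lra.
  move: (e * t) => x; nra.
have h2 : kappa * (eta' / 2) <= fine (nu S).
  have := H (eta' / 2) eta'; rewrite (_ : eta' - eta' / 2 = eta' / 2); last by field.
  by apply; [apply/andP; split; lra|].
have y0 : 0 <= y by rewrite /y divr_ge0 ?mulr_ge0 ?sqr_ge0//; lra.
have h3 : y ^+ 2 / 4 <= expR y.
  rewrite (_ : y = y / 2 + y / 2); last by field.
  rewrite expRD; have := expR_ge1Dx (y / 2).
  move: (expR _) => E hE; nra.
have h4 : c1 / s k ^+ 4 <= mean_lr nu (s k) (e * b).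
  apply: le_trans h1; apply: (@le_trans _ _ (y ^+ 2 / 4 * (kappa * (eta' / 2)))).
    by rewrite le_eqVlt; apply/orP; left; apply/eqP; rewrite /c1 /y; field.
  by apply: ler_pM => //; rewrite ?divr_ge0 ?sqr_ge0 ?mulr_ge0 ?divr_ge0// ltW.
apply: lt_le_trans h4.
rewrite ltr_pdivlMr ?exprn_gt0//.
rewrite (_ : q k * s k ^+ 4 = (q k * s k ^+ 2) * s k ^+ 2); last by ring.
apply: (@le_lt_trans _ _ (Q * s k ^+ 2)); first by rewrite ler_pM2r ?exprn_gt0.
rewrite mulrC -ltr_pdivlMr//; apply: le_lt_trans skc.
by rewrite expr2 ler_piMl// ltW.
Unshelve. all: by end_near.
Qed.

(** Intermediate value theorem between 0, where the mean likelihood ratio is at most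
    one, and 1, where [mean_lr_large] applies. *)
Lemma mean_lr_root : \forall k \near \oo,
  exists2 b, 0 < b & mean_lr nu (s k) (e * b) = q k.
Proof.
near=> k.
have sN : s k != 0 by rewrite gt_eqF.
have q2 : 2 <= q k by near: k.
have big : forall b, 1 <= b -> q k < mean_lr nu (s k) (e * b).
  by near: k; exact: mean_lr_large.
have cont : {within `[0, 1], continuous (fun b => mean_lr nu (s k) (e * b))}.
  apply: continuous_subspaceT => b.
  apply: (@continuous_comp _ _ _ (fun b => e * b)); last exact: continuous_mean_lr.
  by apply: cvgM; [exact: cvg_cst|exact: cvg_id].
have m0 := mean_lr0_le1 nu sN.
have m1 := big 1 (lexx _).
have [] := @IVT R (fun b => mean_lr nu (s k) (e * b)) 0 1 (q k) ler01 cont.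
  rewrite mulr0 ge_min le_max (ltW m1) orbT andbT; apply/orP; left; lra.
move=> b; rewrite in_itv/= => /andP[b0 _] bE; exists b => //.
rewrite lt_neqAle b0 andbT; apply/eqP => b00.
by move: bE; rewrite -b00 mulr0; lra.
Unshelve. all: by end_near.
Qed.

(** By [mean_lr_large] all roots are close to zero, where [mean_lr_le] gives the
    upper bound.  For the lower bound it is enough to count the signals within one
    standard deviation beyond [b]. *)
Lemma mean_lr_root_bounds : exists c C : R, [/\ 0 < c, 0 < C &
  \forall k \near \oo, forall b, 0 < b -> mean_lr nu (s k) (e * b) = q k ->
    c * s k * expR ((b / s k) ^+ 2 / 2) <= q k <= C * s k * expR ((b / s k) ^+ 2 / 2)].
Proof.
have [eta1 [kappa [eta10 kappa0 H]]] := prior_side_window nuP e_sign.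
have K0 := prior_bound_ge0 nuP.
exists (expR (- (1 / 2)) * kappa), (lr_bound e0 K); split.
- by rewrite mulr_gt0 ?expR_gt0.
- rewrite /lr_bound ltr_wpDl ?divr_ge0 ?normal_peak_ge0//.
  by rewrite divr_gt0 ?exprn_gt0.
pose eta := Num.min (eta1 / 2) (e0 / 2).
have eta0 : 0 < eta by rewrite lt_min !divr_gt0.
have etaeta1 : eta <= eta1 / 2 by rewrite ge_min lexx.
have etae0 : eta <= e0 / 2 by rewrite ge_min lexx orbT.
have eta12 : 0 < eta1 / 2 by rewrite divr_gt0.
near=> k => b b0 bE.
have sk0 := s_gt0 k.
have sN : s k != 0 by rewrite gt_eqF.
have sk1 : s k < 1 by near: k; exact: s_small.
have ske : s k < eta1 / 2 by near: k; exact: s_small.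
have be : b < eta.
  rewrite ltNge; apply/negP => be.
  have big : forall b, eta <= b -> q k < mean_lr nu (s k) (e * b).
    by near: k; exact: mean_lr_large.
  by have := big b be; rewrite bE ltxx.
have ebE : (e * b / s k) ^+ 2 = (b / s k) ^+ 2 by rewrite -mulrA exprMn e2 mul1r.
apply/andP; split; last first.
  rewrite -bE -ebE [leRHS]mulrC; apply: (mean_lr_le nuP).
    by rewrite sk0 ltW.
  rewrite normrM (_ : `|e| = 1) ?mul1r; first by rewrite gtr0_norm//; lra.
  by case: e_sign => ->; rewrite ?normrN normr1.
pose S : set R := [set t | b <= e * t <= b + s k].
have h2 : kappa * s k <= fine (nu S).
  have := H b (b + s k); rewrite (_ : b + s k - b = s k); last by ring.
  by apply; [apply/andP; split; lra|lra].
rewrite -bE.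
apply: le_trans
  (@mean_lr_ge _ nu (s k) (e * b) (expR ((b / s k) ^+ 2 / 2 - 1 / 2)) S sN _ _ _).
- rewrite expRD; set E1 := expR ((b / s k) ^+ 2 / 2); set E2 := expR (- (1 / 2)).
  rewrite (_ : E2 * kappa * s k * E1 = E1 * E2 * (kappa * s k)); last by ring.
  by rewrite ler_wpM2l// mulr_ge0// expR_ge0.
- exact: expR_ge0.
- exact: msign.
move=> t /= /andP[t1 t2]; rewrite ler_expR lr_sign.
rewrite ler_pdivlMr ?exprn_gt0//.
have -> : ((b / s k) ^+ 2 / 2 - 1 / 2) * s k ^+ 2 = b ^+ 2 / 2 - s k ^+ 2 / 2 by field.
have : 0 <= (e * t - b) * (s k - (e * t - b)) by apply: mulr_ge0; lra.
have : 0 <= e * t - b by lra.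
move: (e * t) t1 t2 => x t1 t2; nra.
Unshelve. all: by end_near.
Qed.

End LikelihoodRatioRoot.

(** * Size of the mBIC and oracle cutoffs *)

Section PenaltyAsymptotics.
Context {R : realType}.
Variables (sigma d Delta : R) (n : nat -> nat) (p delta : nat -> R).
Hypothesis sigma_gt0 : 0 < sigma.
Hypothesis n_cvg : n @ \oo --> \oo.
Hypothesis n_gt : forall m, (m < n m)%N.
Hypothesis p_itv : forall m, 0 < p m < 1.
Hypothesis p_cvg : p @ \oo --> (0 : R).
Hypothesis delta_gt0 : forall m, 0 < delta m.
Hypothesis delta_le : forall m, delta m <= Delta.
Hypothesis delta_littleo : forall e : R, 0 < e ->
  \forall m \near \oo, `|ln (delta m)| <= e * `|ln (p m)|.

Definition penalty (m : nat) : R := ln (n m)%:R + 2 * ln m%:R + d.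
Definition cutoff (m : nat) : R := Num.sqrt (penalty m).
Definition noise_scale (m : nat) : R := sigma / Num.sqrt (n m)%:R.
(** The value that the mean likelihood ratio takes at the oracle's cutoffs. *)
Definition null_odds (m : nat) : R := (1 - p m) / p m * delta m.

Local Notation c := cutoff.
Local Notation s := noise_scale.
Local Notation q := null_odds.

Let n_gt0 m : 0 < (n m)%:R :> R.
Proof. by rewrite ltr0n (leq_ltn_trans _ (n_gt m)). Qed.

Let sn_gt0 m : 0 < Num.sqrt (n m)%:R :> R. Proof. by rewrite sqrtr_gt0. Qed.

Lemma noise_scale_gt0 m : 0 < s m. Proof. exact: divr_gt0. Qed.

Lemma null_odds_gt0 m : 0 < q m.
Proof. by have /andP[p0 p1] := p_itv m; rewrite mulr_gt0// divr_gt0 ?subr_gt0. Qed.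

Let near_natr_ge (A : R) : \forall m \near \oo, A <= m%:R.
Proof. exact: nbhs_infty_ger. Qed.

Let near_n_ge (A : R) : \forall m \near \oo, A <= (n m)%:R.
Proof. by move/cvgrnyP/cvgryPge : n_cvg; exact. Qed.

Let near_ln_n_ge (A : R) : \forall m \near \oo, A <= ln (n m)%:R.
Proof.
near=> m; rewrite -(expRK A) ler_ln ?posrE ?expR_gt0//.
by near: m; exact: near_n_ge.
Unshelve. all: by end_near.
Qed.

Let near_m_gt0 : \forall m \near \oo, 0 < m%:R :> R.
Proof. by near=> m; rewrite ltr0n; near: m; exists 1%N. Unshelve. all: by end_near. Qed.

Let near_ln_m_ge (A : R) : \forall m \near \oo, A <= ln m%:R.
Proof.
near=> m; have m0 : 0 < m%:R :> R by near: m.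
rewrite -(expRK A) ler_ln ?posrE ?expR_gt0//.
by near: m; exact: near_natr_ge.
Unshelve. all: by end_near.
Qed.

Lemma penalty_ge_ln_n : \forall m \near \oo, ln (n m)%:R <= penalty m.
Proof.
near=> m; have h : `|d| <= ln m%:R by near: m.
have := ler_norm (- d); have := normr_ge0 d; rewrite normrN /penalty; lra.
Unshelve. all: by end_near.
Qed.

Lemma penalty_ge_ln_m : \forall m \near \oo, ln m%:R <= penalty m.
Proof.
near=> m; have h : `|d| <= ln m%:R by near: m.
have h' : 0 <= ln (n m)%:R :> R by near: m.
have := ler_norm (- d); have := normr_ge0 d; rewrite normrN /penalty; lra.
Unshelve. all: by end_near.
Qed.

Lemma penalty_le : \forall m \near \oo, penalty m <= 4 * ln (n m)%:R.
Proof.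
near=> m; have h : `|d| <= ln (n m)%:R by near: m.
have m0 : 0 < m%:R :> R by near: m.
have h' : ln m%:R <= ln (n m)%:R :> R.
  by rewrite ler_ln ?posrE// ler_nat ltnW.
have := ler_norm d; rewrite /penalty; lra.
Unshelve. all: by end_near.
Qed.

Lemma penalty_ge (A : R) : \forall m \near \oo, A <= penalty m.
Proof.
near=> m; apply: (@le_trans _ _ (ln (n m)%:R)); near: m => //.
exact: penalty_ge_ln_n.
Unshelve. all: by end_near.
Qed.

Lemma cutoff_sqr : \forall m \near \oo, cutoff m ^+ 2 = penalty m.
Proof.
near=> m; rewrite sqr_sqrtr//; near: m; exact: penalty_ge.
Unshelve. all: by end_near.
Qed.

Lemma cutoff_cvgy : cutoff @ \oo --> +oo.
Proof.
apply/cvgryPge => A; near=> m.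
apply: (le_trans (ler_norm A)); rewrite -sqrtr_sqr ler_wsqrtr//.
by near: m; exact: penalty_ge.
Unshelve. all: by end_near.
Qed.

(** Since [c ^ 2 <= 4 * ln n <= 8 * sqrt n], the square of [s * c] is at most
    [8 * sigma ^ 2 / sqrt n]. *)
Lemma noise_scale_cutoff_cvg0 : s m * c m @[m --> \oo] --> (0 : R).
Proof.
apply/cvgrPdist_le => eps eps0; near=> m.
have sc0 : 0 <= s m * c m by rewrite mulr_ge0 ?sqrtr_ge0// ltW// noise_scale_gt0.
have eps_ge0 : 0 <= eps := ltW eps0.
rewrite sub0r normrN ger0_norm// -ler_sqr ?nnegrE//.
have cE : c m ^+ 2 = penalty m by near: m; exact: cutoff_sqr.
have pl : penalty m <= 4 * ln (n m)%:R by near: m; exact: penalty_le.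
have nA : (8 * sigma ^+ 2 / eps ^+ 2) ^+ 2 <= (n m)%:R by near: m; exact: near_n_ge.
pose x : R := Num.sqrt (n m)%:R.
have x0 : 0 < x by rewrite /x sqrtr_gt0.
have xE : (n m)%:R = x ^+ 2 :> R by rewrite /x sqr_sqrtr// ltW.
have lnx : ln (n m)%:R <= 2 * x :> R.
  by rewrite xE lnXn// mulr2n; have := ln_sublinear x0; lra.
have Ax : 8 * sigma ^+ 2 / eps ^+ 2 <= x.
  rewrite -ler_sqr ?nnegrE//; first by rewrite -xE.
    by apply: divr_ge0; [apply: mulr_ge0 => //|]; exact: sqr_ge0.
  exact: ltW.
rewrite exprMn cE /s /noise_scale -/x expr_div_n mulrAC ler_pdivrMr ?exprn_gt0//.
apply: (@le_trans _ _ (sigma ^+ 2 * (8 * x))).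
  by rewrite ler_pM2l ?exprn_gt0//; lra.
move: Ax; rewrite ler_pdivrMr ?exprn_gt0// => Ax.
rewrite (_ : sigma ^+ 2 * (8 * x) = 8 * sigma ^+ 2 * x); last by ring.
rewrite (_ : eps ^+ 2 * x ^+ 2 = x * eps ^+ 2 * x); last by ring.
by rewrite ler_pM2r.
Unshelve. all: by end_near.
Qed.

Lemma noise_scale_cvg0 : s @ \oo --> (0 : R).
Proof.
apply: (@squeeze_cvgr _ _ _ _ (cst 0) (fun m => s m * c m)); last 2 first.
- exact: cvg_cst.
- exact: noise_scale_cutoff_cvg0.
near=> m; rewrite (ltW (noise_scale_gt0 _))/= ler_peMr ?(ltW (noise_scale_gt0 _))//.
by near: m; move/cvgryPge : cutoff_cvgy; exact.
Unshelve. all: by end_near.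
Qed.

Lemma expR_cutoff : \forall m \near \oo,
  expR (- (c m ^+ 2 / 2)) = expR (- (d / 2)) / (Num.sqrt (n m)%:R * m%:R).
Proof.
near=> m.
have m0 : 0 < m%:R :> R by near: m.
have cE : c m ^+ 2 = penalty m by near: m; exact: cutoff_sqr.
rewrite cE /penalty.
have -> : - ((ln (n m)%:R + 2 * ln m%:R + d) / 2) =
    - (d / 2) + - (ln (n m)%:R / 2) - ln m%:R :> R by field.
have lnsE : ln (n m)%:R / 2 = ln (Num.sqrt (n m)%:R) :> R.
  by rewrite -{1}(@sqr_sqrtr _ (n m)%:R) ?ltW// lnXn// mulr2n; field.
rewrite !expRD [X in _ * X * _]expRN [X in _ * X]expRN lnsE.
by rewrite !lnK ?posrE// -mulrA -invfM.
Unshelve. all: by end_near.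
Qed.

(** The ratio of losses cannot compensate the sparsity: [- ln delta] is eventually
    at most half of [- ln p]. *)
Lemma null_odds_ge2 : \forall m \near \oo, 2 <= q m.
Proof.
have half0 : 0 < 1 / 2 :> R by lra.
(* p below 4 ^ -2 gives delta / p >= 4, and p below 1 / 2 leaves a factor 2 *)
have e16 : 0 < expR (- (2 * ln 4)) :> R := expR_gt0 _.
near=> m.
have /andP[p0 p1] := p_itv m.
have dl : `|ln (delta m)| <= 1 / 2 * `|ln (p m)| by near: m; exact: delta_littleo.
have lnp0 : ln (p m) < 0 by apply: ln_lt0; rewrite p0.
have pn : `|0 - p m| < 1 / 2 by near: m; move/cvgrPdist_lt : p_cvg => /(_ _ half0).
have pe : `|0 - p m| < expR (- (2 * ln 4)).
  by near: m; move/cvgrPdist_lt : p_cvg => /(_ _ e16).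
rewrite sub0r normrN (gtr0_norm p0) in pn.
rewrite sub0r normrN (gtr0_norm p0) in pe.
have lp : 2 * ln 4 <= - ln (p m).
  rewrite lerNr -(expRK (- _)) ler_ln ?posrE//; exact: ltW.
have ld : - (ln (delta m)) <= 1 / 2 * - ln (p m).
  by apply: le_trans (ler_norm _) _; rewrite normrN -(ltr0_norm lnp0).
have h4 : 4 <= delta m / p m.
  rewrite -ler_ln ?posrE ?divr_gt0// ln_div ?posrE//; lra.
rewrite /q /null_odds.
rewrite (_ : (1 - p m) / p m * delta m = (1 - p m) * (delta m / p m)); last first.
  by rewrite mulrAC mulrA.
move: (delta m / p m) h4 => x h4; nra.
Unshelve. all: by end_near.
Qed.

Lemma noise_scale_sqr m : s m ^+ 2 = sigma ^+ 2 / (n m)%:R.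
Proof. by rewrite /s /noise_scale expr_div_n sqr_sqrtr// ltW. Qed.

Section ManySignals.
Variable r : R.
Hypothesis r_gt0 : 0 < r.
Hypothesis mp_ge : \forall m \near \oo, r <= m%:R * p m.

Let Delta_gt0 : 0 < Delta. Proof. exact: lt_le_trans (delta_gt0 0) (delta_le 0). Qed.

Lemma null_odds_le : \forall m \near \oo, q m <= Delta * m%:R / r.
Proof.
near=> m; have /andP[p0 p1] := p_itv m.
have rm : r <= m%:R * p m by near: m.
have m0 : 0 < m%:R :> R by near: m.
rewrite ler_pdivlMr// /q /null_odds.
apply: (@le_trans _ _ (1 / p m * Delta * (m%:R * p m))); last first.
  rewrite (_ : _ / _ * _ * _ = Delta * m%:R)//.
  by field; rewrite gt_eqF.
have h1 : (1 - p m) / p m <= 1 / p m by rewrite ler_pM2r ?invr_gt0//; lra.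
have h0 : 0 <= (1 - p m) / p m by rewrite divr_ge0 ?subr_ge0 ?(ltW p0) ?(ltW p1).
have d0 := ltW (delta_gt0 m).
apply: ler_pM => //; [exact: mulr_ge0|exact: ltW|].
exact: ler_pM.
Unshelve. all: by end_near.
Qed.

(** By [null_odds_le] the odds are O(m), and [m < n] while [s ^ 2 = sigma ^ 2 / n]. *)
Lemma null_odds_noise_scale_le :
  \forall m \near \oo, q m * s m ^+ 2 <= Delta * sigma ^+ 2 / r.
Proof.
near=> m.
have qm : q m <= Delta * m%:R / r by near: m; exact: null_odds_le.
apply: (@le_trans _ _ (Delta * m%:R / r * s m ^+ 2)).
  by rewrite ler_wpM2r// sqr_ge0.
rewrite noise_scale_sqr.
have -> : Delta * m%:R / r * (sigma ^+ 2 / (n m)%:R) =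
    Delta * sigma ^+ 2 / r * (m%:R / (n m)%:R).
  by field; rewrite !gt_eqF.
have C0 : 0 <= Delta * sigma ^+ 2 / r.
  by apply: divr_ge0; [apply: mulr_ge0; [exact: ltW|exact: sqr_ge0]|exact: ltW].
by rewrite ler_piMr// ler_pdivrMr// mul1r ler_nat ltnW.
Unshelve. all: by end_near.
Qed.

(** By [expR_cutoff] and [null_odds_le] the ratio is at most a constant over [c].
    It compares the false positives of mBIC with the order [s * c] of the
    probability of missing a signal. *)
Lemma mBIC_false_positive_cvg0 :
  q m * (expR (- (c m ^+ 2 / 2)) + expR (- (c m ^+ 2 / 2))) / (s m * c m)
    @[m --> \oo] --> (0 : R).
Proof.
pose C := Delta / r * (2 * expR (- (d / 2))) / sigma.
apply: (@squeeze_cvgr _ _ _ _ (cst 0) (fun m => C * (c m)^-1)); last 2 first.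
- exact: cvg_cst.
- rewrite -[X in _ --> X](mulr0 C); apply: cvgM; first exact: cvg_cst.
  apply/gtr0_cvgV0; last exact: cutoff_cvgy.
  by move/cvgryPgt : cutoff_cvgy; exact.
near=> m.
have c0 : 0 < c m by near: m; move/cvgryPgt : cutoff_cvgy; exact.
have m0 : 0 < m%:R :> R by near: m.
have qm : q m <= Delta * m%:R / r by near: m; exact: null_odds_le.
have eE : expR (- (c m ^+ 2 / 2)) = expR (- (d / 2)) / (Num.sqrt (n m)%:R * m%:R).
  by near: m; exact: expR_cutoff.
have q0 := null_odds_gt0 m; have s0 := noise_scale_gt0 m.
apply/andP; split.
  apply: divr_ge0; apply: mulr_ge0;
    [exact: ltW|by rewrite addr_ge0 ?expR_ge0|exact: ltW|exact: ltW].
rewrite eE ler_pdivrMr; last exact: mulr_gt0.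
apply: (@le_trans _ _ (Delta * m%:R / r *
    (2 * expR (- (d / 2)) / (Num.sqrt (n m)%:R * m%:R)))).
  rewrite (_ : _ + _ = 2 * expR (- (d / 2)) / (Num.sqrt (n m)%:R * m%:R)); last first.
    by rewrite -mulrA mulr_natl mulr2n.
  rewrite ler_wpM2r//; apply: divr_ge0; apply: mulr_ge0 => //.
rewrite /C /s /noise_scale le_eqVlt; apply/orP; left; apply/eqP.
by field; rewrite !gt_eqF.
Unshelve. all: by end_near.
Qed.

Hypothesis ln_mp : ln (m%:R * p m) / ln (n m)%:R @[m --> \oo] --> (0 : R).

(** The difference of [c ^ 2] and [2 * ln (q / s)] consists of [2 * ln (m * p)],
    which is negligible with respect to [ln n], of [2 * ln delta], which is
    negligible with respect to [ln p] and hence to [c ^ 2], and of bounded terms. *)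
Lemma ln_null_odds_cvg :
  2 * ln (q m / s m) / c m ^+ 2 @[m --> \oo] --> (1 : R).
Proof.
apply/cvgrPdist_le => eps eps0.
have e12 : 0 < eps / 12 by rewrite divr_gt0.
have half0 : 0 < 1 / 2 :> R by lra.
near=> m.
have /andP[p0 p1] := p_itv m.
have m0 : 0 < m%:R :> R by near: m.
have cE : c m ^+ 2 = penalty m by near: m; exact: cutoff_sqr.
have ln_n0 : 1 <= ln (n m)%:R :> R by near: m.
have pn : ln (n m)%:R <= penalty m by near: m; exact: penalty_ge_ln_n.
have pm : ln m%:R <= penalty m by near: m; exact: penalty_ge_ln_m.
have pC : (`|d| + `|2 * ln 2| + `|2 * ln sigma|) / (eps / 2) <= penalty m.
  by near: m; exact: penalty_ge.
have pr : `|ln r| <= penalty m by near: m; exact: penalty_ge.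
have rm : r <= m%:R * p m by near: m.
have dl : `|ln (delta m)| <= eps / 12 * `|ln (p m)| by near: m; exact: delta_littleo.
have lmp : `|0 - ln (m%:R * p m) / ln (n m)%:R| <= eps / 12.
  by near: m; move/cvgrPdist_le : ln_mp => /(_ _ e12).
have p12 : `|0 - p m| < 1 / 2 by near: m; move/cvgrPdist_lt : p_cvg => /(_ _ half0).
rewrite sub0r normrN (gtr0_norm p0) in p12.
have pen0 : 0 < penalty m by lra.
rewrite cE -{1}(divff (lt0r_neq0 pen0)) -mulrBl normrM normfV (gtr0_norm pen0).
rewrite ler_pdivrMr//.
have qsE : ln (q m / s m) = ln (1 - p m) - ln (p m) + ln (delta m)
    - ln sigma + ln (n m)%:R / 2.
  have h1p : 0 < 1 - p m by lra.
  rewrite ln_div ?posrE ?null_odds_gt0 ?noise_scale_gt0//.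
  rewrite /q /null_odds lnM ?posrE ?divr_gt0// ln_div ?posrE//.
  rewrite /s /noise_scale ln_div ?posrE//.
  rewrite -[in RHS](@sqr_sqrtr _ (n m)%:R) ?ltW// lnXn// -mulr_natl.
  by field.
have lnmp : ln (m%:R * p m) = ln m%:R + ln (p m) by rewrite lnM ?posrE.
have -> : penalty m - 2 * ln (q m / s m) =
    2 * ln (m%:R * p m) + d - 2 * ln (1 - p m) - 2 * ln (delta m) + 2 * ln sigma.
  by rewrite qsE lnmp /penalty; field.
have t1 : `|2 * ln (m%:R * p m)| <= eps / 6 * penalty m.
  move: lmp; rewrite sub0r normrN normrM normfV (@gtr0_norm _ (ln (n m)%:R)); last lra.
  rewrite ler_pdivrMr; last lra.
  move=> h; rewrite normrM ger0_norm//.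
  have : eps / 12 * ln (n m)%:R <= eps / 12 * penalty m by rewrite ler_pM2l.
  lra.
have t2 : `|2 * ln (delta m)| <= eps / 3 * penalty m.
  have lp : `|ln (p m)| <= 2 * penalty m.
    rewrite ltr0_norm; last by apply: ln_lt0; rewrite p0.
    have : ln r <= ln (m%:R * p m) by rewrite ler_ln ?posrE// mulr_gt0.
    have := ler_norm (- ln r); rewrite normrN lnmp; lra.
  rewrite normrM ger0_norm//.
  have : eps / 12 * `|ln (p m)| <= eps / 12 * (2 * penalty m) by rewrite ler_pM2l.
  lra.
have t3 : `|2 * ln (1 - p m)| <= `|2 * ln 2|.
  rewrite !normrM ler_wpM2l// ltr0_norm; last by apply: ln_lt0; lra.
  rewrite gtr0_norm; last by apply: ln_gt0; lra.
  rewrite -lnV ?posrE; last lra.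
  rewrite ler_ln ?posrE ?invr_gt0//; last lra.
  by rewrite -[leRHS]invrK lef_pV2 ?posrE ?invr_gt0//; lra.
have t4 : `|d| + `|2 * ln 2| + `|2 * ln sigma| <= eps / 2 * penalty m.
  by move: pC; rewrite ler_pdivrMr ?divr_gt0// (mulrC (penalty m)).
have n1 := ler_normD
  (2 * ln (m%:R * p m) + d - 2 * ln (1 - p m) - 2 * ln (delta m)) (2 * ln sigma).
have n2 := ler_normB (2 * ln (m%:R * p m) + d - 2 * ln (1 - p m)) (2 * ln (delta m)).
have n3 := ler_normB (2 * ln (m%:R * p m) + d) (2 * ln (1 - p m)).
have n4 := ler_normD (2 * ln (m%:R * p m)) d.
lra.
Unshelve. all: by end_near.
Qed.

(** Taking logarithms, the two bounds say that [u ^ 2] is [2 * ln (q / s)] up to a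
    constant. *)
Lemma oracle_cutoff_cvg (u : nat -> R) (a b : R) : 0 < a -> 0 < b ->
  (\forall m \near \oo, 0 < u m /\
    a * s m * expR (u m ^+ 2 / 2) <= q m <= b * s m * expR (u m ^+ 2 / 2)) ->
  u m / c m @[m --> \oo] --> (1 : R).
Proof.
move=> a0 b0 hu.
have c0 : \forall m \near \oo, 0 < c m by move/cvgryPgt : cutoff_cvgy; exact.
have cV : (c m ^+ 2)^-1 @[m --> \oo] --> (0 : R).
  have h : (c m)^-1 @[m --> \oo] --> (0 : R).
    by apply/(gtr0_cvgV0 c0); exact: cutoff_cvgy.
  rewrite (_ : (fun m => (c m ^+ 2)^-1) = (fun m => (c m)^-1 * (c m)^-1)); last first.
    by apply/funext => m; rewrite -exprVn expr2.
  have := cvgM h h; rewrite mulr0; exact.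
have sqr_cvg : u m ^+ 2 / c m ^+ 2 @[m --> \oo] --> (1 : R).
  apply: (@squeeze_cvgr _ _ _ _
    (fun m => 2 * ln (q m / s m) / c m ^+ 2 - 2 * ln b * (c m ^+ 2)^-1)
    (fun m => 2 * ln (q m / s m) / c m ^+ 2 - 2 * ln a * (c m ^+ 2)^-1)); last 2 first.
  - rewrite -[X in _ --> X]subr0 -(mulr0 (2 * ln b)).
    apply: cvgB; first exact: ln_null_odds_cvg.
    by apply: cvgM => //; exact: cvg_cst.
  - rewrite -[X in _ --> X]subr0 -(mulr0 (2 * ln a)).
    apply: cvgB; first exact: ln_null_odds_cvg.
    by apply: cvgM => //; exact: cvg_cst.
  near=> m.
  have cm0 : 0 < c m by near: m.
  have [um0 /andP[h1 h2]] : 0 < u m /\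
    a * s m * expR (u m ^+ 2 / 2) <= q m <= b * s m * expR (u m ^+ 2 / 2).
    by near: m.
  have s0 := noise_scale_gt0 m.
  rewrite -!mulrBl !ler_pM2r ?invr_gt0 ?exprn_gt0//.
  have e0 := expR_gt0 (u m ^+ 2 / 2).
  have ae0 := mulr_gt0 a0 e0; have be0 := mulr_gt0 b0 e0.
  have qs0 : 0 < q m / s m by rewrite divr_gt0// null_odds_gt0.
  have g1 : ln a + u m ^+ 2 / 2 <= ln (q m / s m).
    rewrite -[X in _ + X]expRK -lnM ?posrE// ler_ln ?posrE//.
    by rewrite ler_pdivlMr// mulrAC.
  have g2 : ln (q m / s m) <= ln b + u m ^+ 2 / 2.
    rewrite -[X in _ + X]expRK -lnM ?posrE// ler_ln ?posrE//.
    by rewrite ler_pdivrMr// mulrAC.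
  apply/andP; split; lra.
have : Num.sqrt (u m ^+ 2 / c m ^+ 2) @[m --> \oo] --> (Num.sqrt 1 : R).
  by apply: continuous_cvg => //; exact: sqrt_continuous.
rewrite sqrtr1; apply: cvg_trans; apply: near_eq_cvg; near=> m.
have cm0 : 0 < c m by near: m.
have [um0 _] : 0 < u m /\
    a * s m * expR (u m ^+ 2 / 2) <= q m <= b * s m * expR (u m ^+ 2 / 2).
  by near: m.
by rewrite -expr_div_n sqrtr_sqr gtr0_norm// divr_gt0.
Unshelve. all: by end_near.
Qed.

End ManySignals.
End PenaltyAsymptotics.

(** * The two rules as threshold rules and their asymptotic risk *)

Section OracleThresholds.
Context {R : realType}.
Variables (sigma : R) (nu : probability R R) (n : nat) (p delta0 deltaA : R).
Hypotheses (sigma_gt0 : 0 < sigma) (n_gt0 : (0 < n)%N).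
Hypotheses (p_gt0 : 0 < p) (deltaA_gt0 : 0 < deltaA).

Let s : R := sigma / Num.sqrt n%:R.

Let sn_gt0 : 0 < Num.sqrt n%:R :> R. Proof. by rewrite sqrtr_gt0 ltr0n. Qed.
Let s_gt0 : 0 < s. Proof. exact: divr_gt0. Qed.

Lemma oracle_equationE a : oracle_equation sigma nu n p delta0 deltaA a <->
  mean_lr nu s a = (1 - p) / p * (delta0 / deltaA).
Proof.
have sN : s != 0 by rewrite gt_eqF.
rewrite /oracle_equation.
have -> : (\int[nu]_mu (expR (n%:R * (a * (mu / sigma ^+ 2)
    - mu ^+ 2 / (2 * sigma ^+ 2))))%:E)%E = (mean_lr nu s a)%:E.
  rewrite mean_lrE//; apply: eq_integral => t _; congr (expR _)%:E.
  rewrite /s expr_div_n sqr_sqrtr ?ler0n//; field.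
  by rewrite !gt_eqF// ltr0n.
rewrite -EFinM; split => [[] h|->].
  apply: (@mulfI _ (p * deltaA)); first by rewrite gt_eqF// mulr_gt0.
  by rewrite -h; field; rewrite !gt_eqF.
by congr EFin; field; rewrite !gt_eqF.
Qed.

Variables (m : nat) (X : 'M[R]_(n, m.+1)).

Lemma bayes_oracle_threshold_rule :
  threshold_rule X sigma (bayes_oracle sigma nu p delta0 deltaA X)
    (- oracle_lower sigma nu n p delta0 deltaA / s)
    (oracle_upper sigma nu n p delta0 deltaA / s).
Proof.
move=> Y i; rewrite !inE -!/s mulNr !opprK !(ler_pM2r, ltr_pM2r) ?invr_gt0//.
split; first by rewrite negb_and -!leNgt => /orP[]; [left|right].
by rewrite negbK => /andP[/ltW -> /ltW ->].
Qed.

End OracleThresholds.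

Section MBICThreshold.
Context {R : realType} {n m : nat}.
Variables (X : 'M[R]_(n, m.+1)) (sigma d : R) (rule : 'cV[R]_n -> {set 'I_m}).
Hypotheses (n_gt0 : (0 < n)%N) (X_orth : orthogonal_design X).
Hypotheses (sigma_gt0 : 0 < sigma) (rule_min : is_mBIC_rule sigma d X rule).

Lemma mBIC_threshold_rule (c : R) : 0 <= c ->
  c ^+ 2 = ln n%:R + 2 * ln m%:R + d -> threshold_rule X sigma rule c c.
Proof.
move=> c0 cE Y i.
have nR0 : 0 < n%:R :> R by rewrite ltr0n.
have sn0 : 0 < Num.sqrt n%:R :> R by rewrite sqrtr_gt0.
set t := lse X Y i / _.
have tE : n%:R * lse X Y i ^+ 2 / sigma ^+ 2 = t ^+ 2.
  rewrite /t -{1}(@sqr_sqrtr _ n%:R) ?ler0n//; field.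
  by rewrite !gt_eqF.
split.
  move/(mBIC_rule_selected n_gt0 X_orth sigma_gt0 rule_min).
  rewrite tE -cE => h.
  have [tc|ct] := leP t (- c); [by left|right].
  have [//|tc] := leP c t.
  have : 0 < (c - t) * (c + t) by apply: mulr_gt0; lra.
  by rewrite -subr_sqr; lra.
move/(mBIC_rule_unselected n_gt0 X_orth sigma_gt0 rule_min).
rewrite tE -cE => h.
by rewrite -ler_norml -ler_sqr ?nnegrE// real_normK ?num_real.
Qed.

End MBICThreshold.

Section BayesOracleMeasurable.
Context {R : realType} {d : measure_display} {T : measurableType d}.
Variable P : probability T R.
Context {n m : nat}.
Variables (X : 'M[R]_(n, m.+1)) (b0 : R).
Variables (beta : 'I_m -> {RV P >-> R}) (eps : 'I_n -> {RV P >-> R}).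
Variables (sigma : R) (nu : probability R R) (p delta0 deltaA : R).
Hypotheses (n_gt0 : (0 < n)%N) (X_orth : orthogonal_design X) (sigma_gt0 : 0 < sigma).

Lemma measurable_bayes_oracle :
  measurable_rule X b0 beta eps (bayes_oracle sigma nu p delta0 deltaA X).
Proof.
move=> i.
set a := oracle_lower sigma nu n p delta0 deltaA.
set b := oracle_upper sigma nu n p delta0 deltaA.
rewrite (_ : [set w | _] =
  (fun w => beta i w + sigma / Num.sqrt n%:R * noise X eps sigma i w) @^-1`
    (~` `]a, b[%classic)); last first.
  apply/seteqP; split => w /=; rewrite /bayes_oracle finset.in_set;
    by rewrite (lse_response _ _ _ n_gt0 X_orth sigma_gt0) in_itv => /negP.
rewrite -[X in measurable X]setTI.
suff : measurable_fun [set: T]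
    (fun w => beta i w + sigma / Num.sqrt n%:R * noise X eps sigma i w).
  by apply => //; exact: measurableC.
apply: measurable_funD => //; apply: measurable_funM => //.
exact: measurable_noise.
Qed.

End BayesOracleMeasurable.

Section ThresholdRisk.
Context {R : realType}.
Variables (sigma : R) (nu : probability R R) (e0 K rhom rhop : R) (rho : R -> R).
Hypothesis sigma_gt0 : 0 < sigma.
Hypothesis nuP : prior_near0 nu e0 K rhom rhop rho.

Let nu_zero := prior_no_atom nuP.

Variables (n : nat -> nat) (p delta0 deltaA b0 : nat -> R)
  (X : forall m, 'M[R]_(n m, m.+1))
  (disp : nat -> measure_display) (T : forall m, measurableType (disp m))
  (P : forall m, probability (T m) R)
  (beta : forall m, 'I_m -> {RV (P m) >-> R})
  (eps : forall m, 'I_(n m) -> {RV (P m) >-> R})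
  (rule : forall m, 'cV[R]_(n m) -> {set 'I_m}).
Hypotheses (n_gt0 : forall m, (0 < n m)%N) (p_itv : forall m, 0 < p m < 1).
Hypotheses (delta0_gt0 : forall m, 0 < delta0 m) (deltaA_gt0 : forall m, 0 < deltaA m).
Hypothesis X_orth : forall m, orthogonal_design (X m).
Hypothesis model : forall m, sparse_model (@beta m) (@eps m) sigma (p m) nu.
Hypothesis rule_meas : forall m,
  measurable_rule (X m) (b0 m) (@beta m) (@eps m) (@rule m).

Let s := noise_scale sigma n.
Let q := null_odds p (fun m => delta0 m / deltaA m).

Variables (l u v : nat -> R).
Hypothesis l_cvg : l @ \oo --> +oo.
Hypothesis sl_cvg : s m * l m @[m --> \oo] --> (0 : R).
Hypothesis u_cvg : u m / l m @[m --> \oo] --> (1 : R).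
Hypothesis v_cvg : v m / l m @[m --> \oo] --> (1 : R).
Hypothesis uv_rule : \forall m \near \oo,
  [/\ 0 <= u m, 0 <= v m & threshold_rule (X m) sigma (@rule m) (u m) (v m)].
Hypothesis false_positive : q m * (expR (- (u m ^+ 2 / 2)) + expR (- (v m ^+ 2 / 2)))
  / (s m * l m) @[m --> \oo] --> (0 : R).

Let s_gt0 m : 0 < s m.
Proof. by rewrite /s /noise_scale divr_gt0// sqrtr_gt0 ltr0n. Qed.

(** False positives are negligible by assumption, and [risk_le] and [risk_ge]
    enclose the normalised risk between two probabilities of missing a signal
    which have the same limit by [miss_prob_cvg]. *)
Lemma threshold_risk_cvg :
  fine (risk (X m) (b0 m) (@beta m) (@eps m) (delta0 m) (deltaA m) (@rule m))
    / (m%:R * p m * deltaA m * (s m * l m)) @[m --> \oo] --> rhom + rhop.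
Proof.
have l0 : \forall m \near \oo, 0 < l m by move/cvgryPgt : l_cvg; exact.
have linv : (l m)^-1 @[m --> \oo] --> (0 : R) by exact/(gtr0_cvgV0 l0).
have shift (x : nat -> R) : x m / l m @[m --> \oo] --> (1 : R) ->
    (x m - 1) / l m @[m --> \oo] --> (1 : R).
  move=> xc; rewrite (_ : (fun m => _) = (fun m => x m / l m - (l m)^-1)); last first.
    by apply/funext => m; rewrite mulrBl mul1r.
  by have := cvgB xc linv; rewrite subr0; exact.
have upper := miss_prob_cvg nuP s_gt0 sl_cvg l_cvg u_cvg v_cvg.
have lower := miss_prob_cvg nuP s_gt0 sl_cvg l_cvg (shift _ u_cvg) (shift _ v_cvg).
apply: (squeeze_cvgr _ lower); last first.
  have := cvgD false_positive upper; rewrite add0r; exact.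
near=> m.
have lm : 0 < l m by near: m.
have m0 : 0 < m%:R :> R by rewrite ltr0n; near: m; exists 1%N.
have [um vm ruv] : [/\ 0 <= u m, 0 <= v m &
  threshold_rule (X m) sigma (@rule m) (u m) (v m)] by near: m.
have /andP[p0 p1] := p_itv m.
have sm := s_gt0 m; have d0 := delta0_gt0 m; have dA := deltaA_gt0 m.
have le := risk_le (n_gt0 m) (X_orth m) sigma_gt0 (p_itv m) nu_zero (model m)
  ruv (@rule_meas m) (ltW d0) (ltW dA) um vm.
have ge := risk_ge (n_gt0 m) (X_orth m) sigma_gt0 (p_itv m) nu_zero (model m)
  ruv (@rule_meas m) (ltW d0) (ltW dA).
set rk := risk _ _ _ _ _ _ _ in le ge *.
have rk_fin : rk \is a fin_num.
  by rewrite fin_numElt (lt_le_trans (ltNyr _) ge) (le_lt_trans le (ltry _)).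
move: le ge; rewrite -(fineK rk_fin) !lee_fin => le ge.
have sl0 := mulr_gt0 sm lm.
have N0 := mulr_gt0 (mulr_gt0 (mulr_gt0 m0 p0) dA) sl0.
apply/andP; split.
  apply: (@le_trans _ _ (
      m%:R * (deltaA m * (p m * miss_prob nu (s m) (u m - 1) (v m - 1)))
      / (m%:R * p m * deltaA m * (s m * l m)))).
    by rewrite le_eqVlt; apply/orP; left; apply/eqP; field; rewrite !gt_eqF.
  by rewrite ler_pM2r ?invr_gt0.
apply: (@le_trans _ _ (m%:R * (delta0 m * ((1 - p m) *
     (expR (- (u m ^+ 2 / 2)) + expR (- (v m ^+ 2 / 2))))
    + deltaA m * (p m * miss_prob nu (s m) (u m) (v m)))
      / (m%:R * p m * deltaA m * (s m * l m)))).
  by rewrite ler_pM2r ?invr_gt0.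
rewrite le_eqVlt; apply/orP; left; apply/eqP; rewrite fctE /q /null_odds.
field.
by rewrite !gt_eqF.
Unshelve. all: by end_near.
Qed.

End ThresholdRisk.

(** * Optimality and consistency *)

Section SparseSelection.
Context {R : realType}.
Variables (sigma d Delta : R) (nu : probability R R).
Variables (e0 K rhom rhop : R) (rho : R -> R).
Variables (n : nat -> nat) (p delta0 deltaA b0 : nat -> R)
  (X : forall m, 'M[R]_(n m, m.+1))
  (disp : nat -> measure_display) (T : forall m, measurableType (disp m))
  (P : forall m, probability (T m) R)
  (beta : forall m, 'I_m -> {RV (P m) >-> R})
  (eps : forall m, 'I_(n m) -> {RV (P m) >-> R})
  (mbic : forall m, 'cV[R]_(n m) -> {set 'I_m}).
Hypotheses (sigma_gt0 : 0 < sigma) (nuP : prior_near0 nu e0 K rhom rhop rho).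
Hypotheses (n_gt0 : forall m, (0 < n m)%N) (p_itv : forall m, 0 < p m < 1).
Hypotheses (delta0_gt0 : forall m, 0 < delta0 m) (deltaA_gt0 : forall m, 0 < deltaA m).
Hypothesis X_orth : forall m, orthogonal_design (X m).
Hypothesis model : forall m, sparse_model (@beta m) (@eps m) sigma (p m) nu.
Hypotheses (n_cvg : n @ \oo --> \oo) (p_cvg : p @ \oo --> (0 : R)).
Hypothesis delta_le : forall m, delta0 m / deltaA m <= Delta.
Hypothesis delta_littleo : forall e : R, 0 < e ->
  \forall m \near \oo, `|ln (delta0 m / deltaA m)| <= e * `|ln (p m)|.
Hypothesis mbic_min : forall m, is_mBIC_rule sigma d (X m) (@mbic m).
Hypothesis mbic_meas : forall m,
  measurable_rule (X m) (b0 m) (@beta m) (@eps m) (@mbic m).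

Let s := noise_scale sigma n.
Let c := cutoff d n.
Let q := null_odds p (fun m => delta0 m / deltaA m).

Let nu_zero := prior_no_atom nuP.

Let n_gt m : (m < n m)%N := orthogonal_design_lt (n_gt0 m) (X_orth m).

Let delta_gt0 m : 0 < delta0 m / deltaA m. Proof. exact: divr_gt0. Qed.

Let s_gt0 m : 0 < s m := noise_scale_gt0 sigma_gt0 n_gt m.

Let q_gt0 m : 0 < q m := null_odds_gt0 p_itv delta_gt0 m.

Let c_cvgy : c @ \oo --> +oo := cutoff_cvgy d n_cvg n_gt.

Let sc_cvg : s m * c m @[m --> \oo] --> (0 : R) :=
  noise_scale_cutoff_cvg0 d sigma_gt0 n_cvg n_gt.

Let c_gt0 : \forall m \near \oo, 0 < c m.
Proof. by move/cvgryPgt : c_cvgy; exact. Qed.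

Let cc_cvg : c m / c m @[m --> \oo] --> (1 : R).
Proof.
apply: cvg_near_cst; near=> m; rewrite divff// gt_eqF//; near: m; exact: c_gt0.
Unshelve. all: by end_near.
Qed.

Lemma mBIC_cutoff_rule : \forall m \near \oo,
  [/\ 0 <= c m, 0 <= c m & threshold_rule (X m) sigma (@mbic m) (c m) (c m)].
Proof.
near=> m; have cm : 0 < c m by near: m; exact: c_gt0.
split; [exact: ltW|exact: ltW|].
apply: (mBIC_threshold_rule (n_gt0 m) (X_orth m) sigma_gt0 (@mbic_min m)); first exact: ltW.
near: m; exact: cutoff_sqr.
Unshelve. all: by end_near.
Qed.

Section ManySignals.
Variable r : R.
Hypotheses (r_gt0 : 0 < r) (mp_ge : \forall m \near \oo, r <= m%:R * p m).
Hypothesis ln_mp : ln (m%:R * p m) / ln (n m)%:R @[m --> \oo] --> (0 : R).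

Let equation m := oracle_equation sigma nu (n m) (p m) (delta0 m) (deltaA m).

Let equationE m a : equation m a <-> mean_lr nu (s m) a = q m.
Proof. by have /andP[p_gt0 _] := p_itv m; exact: oracle_equationE. Qed.

Lemma mBIC_risk_cvg :
  fine (risk (X m) (b0 m) (@beta m) (@eps m) (delta0 m) (deltaA m) (@mbic m))
    / (m%:R * p m * deltaA m * (s m * c m)) @[m --> \oo] --> rhom + rhop.
Proof.
have fp := mBIC_false_positive_cvg0 d sigma_gt0 n_cvg n_gt p_itv delta_gt0
  delta_le r_gt0 mp_ge.
exact: (threshold_risk_cvg sigma_gt0 nuP n_gt0 p_itv delta0_gt0 deltaA_gt0
  X_orth model mbic_meas c_cvgy sc_cvg cc_cvg cc_cvg mBIC_cutoff_rule fp).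
Qed.

(** The sign [e] stands for the upper or the lower cutoff of the oracle, and the
    second hypothesis is what the choice operator in their definition provides. *)
Lemma oracle_threshold_bounds (e : R) (a : nat -> R) : e = 1 \/ e = -1 ->
  (forall m, (exists x, 0 < e * x /\ equation m x) -> 0 < e * a m /\ equation m (a m)) ->
  exists lo hi : R, [/\ 0 < lo, 0 < hi & \forall m \near \oo,
    0 < e * a m / s m /\
    lo * s m * expR ((e * a m / s m) ^+ 2 / 2) <= q m
      <= hi * s m * expR ((e * a m / s m) ^+ 2 / 2)].
Proof.
move=> e_sign a_root.
have eK x : e * (e * x) = x by case: e_sign => ->; ring.
have Q_gt0 : 0 < Delta * sigma ^+ 2 / r.
  by rewrite divr_gt0// mulr_gt0 ?exprn_gt0// (lt_le_trans (delta_gt0 0) (delta_le 0)).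
have s_cvg : s @ \oo --> (0 : R) := noise_scale_cvg0 d sigma_gt0 n_cvg n_gt.
have q_ge2 : \forall m \near \oo, 2 <= q m :=
  null_odds_ge2 p_itv p_cvg delta_gt0 delta_littleo.
have q_le : \forall m \near \oo, q m * s m ^+ 2 <= Delta * sigma ^+ 2 / r :=
  null_odds_noise_scale_le sigma n_gt p_itv delta_gt0 delta_le r_gt0 mp_ge.
have root := mean_lr_root nuP s_gt0 s_cvg q_ge2 Q_gt0 q_le e_sign.
have [lo [hi [lo_gt0 hi_gt0 bound]]] :=
  mean_lr_root_bounds nuP s_gt0 s_cvg Q_gt0 q_le e_sign.
exists lo, hi; split => //; near=> m.
have [b b_gt0 bE] : exists2 b, 0 < b & mean_lr nu (s m) (e * b) = q m.
  by near: m; exact: root.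
have [ea_gt0 aE] : 0 < e * a m /\ equation m (a m).
  by apply: a_root; exists (e * b); rewrite eK; split => //; exact/equationE.
split; first exact: divr_gt0.
have bound_m : forall b, 0 < b -> mean_lr nu (s m) (e * b) = q m ->
    lo * s m * expR ((b / s m) ^+ 2 / 2) <= q m <= hi * s m * expR ((b / s m) ^+ 2 / 2).
  by near: m; exact: bound.
by apply: bound_m => //; rewrite eK; exact/equationE.
Unshelve. all: by end_near.
Qed.

(** Any root satisfies [q * exp (- u ^ 2 / 2) = O(s)], and this divided by [s * c]
    tends to zero. *)
Lemma bayes_oracle_risk_cvg :
  fine (risk (X m) (b0 m) (@beta m) (@eps m) (delta0 m) (deltaA m)
          (bayes_oracle sigma nu (p m) (delta0 m) (deltaA m) (X m)))
    / (m%:R * p m * deltaA m * (s m * c m)) @[m --> \oo] --> rhom + rhop.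
Proof.
pose lower m := oracle_lower sigma nu (n m) (p m) (delta0 m) (deltaA m).
pose upper m := oracle_upper sigma nu (n m) (p m) (delta0 m) (deltaA m).
(* the signs make the cutoffs instances of [oracle_threshold_bounds] *)
pose u m := -1 * lower m / s m; pose v m := 1 * upper m / s m.
have [uL [uH [uL_gt0 uH_gt0 uP]]] : exists lo hi : R, [/\ 0 < lo, 0 < hi &
    \forall m \near \oo, 0 < u m /\ lo * s m * expR (u m ^+ 2 / 2) <= q m
      <= hi * s m * expR (u m ^+ 2 / 2)].
  apply: oracle_threshold_bounds; first by right.
  move=> m [x [x0 xE]].
  have [lower_lt0 lowerE] : lower m < 0 /\ equation m (lower m).
    apply: (@xgetPex _ 0 [set a | a < 0 /\ equation m a]); exists x; split => //.
    by rewrite -oppr_gt0 -mulN1r.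
  by rewrite mulN1r oppr_gt0.
have [vL [vH [vL_gt0 vH_gt0 vP]]] : exists lo hi : R, [/\ 0 < lo, 0 < hi &
    \forall m \near \oo, 0 < v m /\ lo * s m * expR (v m ^+ 2 / 2) <= q m
      <= hi * s m * expR (v m ^+ 2 / 2)].
  apply: oracle_threshold_bounds; first by left.
  move=> m [x [x0 xE]]; rewrite mul1r.
  apply: (@xgetPex _ 0 [set a | 0 < a /\ equation m a]); exists x; split => //.
  by rewrite -[x]mul1r.
have u_cvg := oracle_cutoff_cvg d sigma_gt0 n_cvg n_gt p_itv p_cvg delta_gt0
  delta_littleo r_gt0 mp_ge ln_mp uL_gt0 uH_gt0 uP.
have v_cvg := oracle_cutoff_cvg d sigma_gt0 n_cvg n_gt p_itv p_cvg delta_gt0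
  delta_littleo r_gt0 mp_ge ln_mp vL_gt0 vH_gt0 vP.
have u_pos : \forall m \near \oo, 0 < u m by apply: filterS uP => m [].
have v_pos : \forall m \near \oo, 0 < v m by apply: filterS vP => m [].
have u_hi : \forall m \near \oo, q m <= uH * s m * expR (u m ^+ 2 / 2).
  by apply: filterS uP => m [_ /andP[]].
have v_hi : \forall m \near \oo, q m <= vH * s m * expR (v m ^+ 2 / 2).
  by apply: filterS vP => m [_ /andP[]].
have uv_rule : \forall m \near \oo, [/\ 0 <= u m, 0 <= v m &
    threshold_rule (X m) sigma
      (bayes_oracle sigma nu (p m) (delta0 m) (deltaA m) (X m)) (u m) (v m)].
  near=> m; split; [by apply/ltW; near: m|by apply/ltW; near: m|].
  by rewrite /u /v mulN1r mul1r; exact: bayes_oracle_threshold_rule.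
have fp : q m * (expR (- (u m ^+ 2 / 2)) + expR (- (v m ^+ 2 / 2))) / (s m * c m)
    @[m --> \oo] --> (0 : R).
  apply: (@squeeze_cvgr _ _ _ _ (cst 0) (fun m => (uH + vH) * (c m)^-1)); last 2 first.
  - exact: cvg_cst.
  - rewrite -[X in _ --> X](mulr0 (uH + vH)); apply: cvgM; first exact: cvg_cst.
    by apply/gtr0_cvgV0.
  near=> m.
  have cm : 0 < c m by near: m; exact: c_gt0.
  have uq : q m <= uH * s m * expR (u m ^+ 2 / 2) by near: m.
  have vq : q m <= vH * s m * expR (v m ^+ 2 / 2) by near: m.
  have sc_gt0 := mulr_gt0 (s_gt0 m) cm.
  apply/andP; split.
    apply: divr_ge0; last exact: ltW.
    by apply: mulr_ge0; [exact: ltW|rewrite addr_ge0 ?expR_ge0].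
  rewrite ler_pdivrMr// (_ : (uH + vH) * (c m)^-1 * (s m * c m) = uH * s m + vH * s m).
    by rewrite mulrDr !expRN; apply: lerD; rewrite ler_pdivrMr ?expR_gt0.
  by field; rewrite gt_eqF.
exact: (threshold_risk_cvg sigma_gt0 nuP n_gt0 p_itv delta0_gt0 deltaA_gt0 X_orth model
  (fun m => measurable_bayes_oracle (b0 m) (@beta m) (@eps m) nu (p m)
     (delta0 m) (deltaA m) (n_gt0 m) (X_orth m) sigma_gt0)
  c_cvgy sc_cvg u_cvg v_cvg uv_rule fp).
Unshelve. all: by end_near.
Qed.

Lemma mBIC_ABOS :
  fine (risk (X m) (b0 m) (@beta m) (@eps m) (delta0 m) (deltaA m) (@mbic m))
  / fine (risk (X m) (b0 m) (@beta m) (@eps m) (delta0 m) (deltaA m)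
            (bayes_oracle sigma nu (p m) (delta0 m) (deltaA m) (X m)))
    @[m --> \oo] --> (1 : R).
Proof.
pose A m := fine (risk (X m) (b0 m) (@beta m) (@eps m) (delta0 m) (deltaA m) (@mbic m)).
pose B m := fine (risk (X m) (b0 m) (@beta m) (@eps m) (delta0 m) (deltaA m)
  (bayes_oracle sigma nu (p m) (delta0 m) (deltaA m) (X m))).
pose N m := m%:R * p m * deltaA m * (s m * c m).
have rho_neq0 : rhom + rhop != 0.
  have l0 := prior_density_left_gt0 nuP; have r0 := prior_density_right_gt0 nuP.
  by rewrite gt_eqF// addr_gt0.
have ratio : A m / N m * (B m / N m)^-1 @[m --> \oo] --> (1 : R).
  rewrite -(divff rho_neq0); apply: cvgM; first exact: mBIC_risk_cvg.
  by apply: cvgV => //; exact: bayes_oracle_risk_cvg.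
apply: cvg_trans ratio; apply: near_eq_cvg.
near=> m.
have m_gt0 : 0 < m%:R :> R by rewrite ltr0n; near: m; exists 1%N.
have /andP[p_gt0 _] := p_itv m.
have cm : 0 < c m by near: m; exact: c_gt0.
have N_gt0 := mulr_gt0 (mulr_gt0 (mulr_gt0 m_gt0 p_gt0) (deltaA_gt0 m))
  (mulr_gt0 (s_gt0 m) cm).
by rewrite /= invf_div mulrA mulfVK// gt_eqF.
Unshelve. all: by end_near.
Qed.

End ManySignals.

Section Consistency.
Hypothesis mp_sqrt :
  m%:R * p m * Num.sqrt (ln (n m)%:R / (n m)%:R) @[m --> \oo] --> (0 : R).

Let correct m := [set w | mbic (response (X m) (b0 m) (@beta m) (@eps m) w)
                          = true_model (@beta m) w].

Let measurable_correct_mbic m : measurable (@correct m) :=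
  measurable_correct (@mbic_meas m).

Let error_bound m :=
  m%:R * (expR (- (c m ^+ 2 / 2)) + expR (- (c m ^+ 2 / 2)))
  + m%:R * p m * miss_prob nu (s m) (c m) (c m).

Lemma prob_incorrect_le : \forall m \near \oo,
  (P m (~` @correct m) <= (error_bound m)%:E)%E.
Proof.
near=> m.
have [c_ge0 _ c_thr] : [/\ 0 <= c m, 0 <= c m &
  threshold_rule (X m) sigma (@mbic m) (c m) (c m)] by near: m; exact: mBIC_cutoff_rule.
have /andP[p_gt0 p_lt1] := p_itv m.
apply: le_trans (prob_incorrect_le_risk (@mbic_meas m)) _.
apply: le_trans (risk_le (n_gt0 m) (X_orth m) sigma_gt0 (p_itv m) nu_zero
  (model m) c_thr (@mbic_meas m) ler01 ler01 c_ge0 c_ge0) _.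
rewrite /error_bound lee_fin !mul1r mulrDr -mulrA; apply: lerD => //.
apply: ler_wpM2l => //; rewrite ler_piMl ?addr_ge0 ?expR_ge0//; lra.
Unshelve. all: by end_near.
Qed.

(** The first term is of order [1 / sqrt n].  In the second one the probability of
    missing a signal is of order [s * c] with [c <= 2 * sqrt (ln n)]. *)
Lemma error_bound_cvg0 : error_bound m @[m --> \oo] --> (0 : R).
Proof.
have miss_c := miss_prob_cvg nuP s_gt0 sc_cvg c_cvgy cc_cvg cc_cvg.
have noise_cvg : 2 * expR (- (d / 2)) / sigma * s m @[m --> \oo] --> (0 : R).
  rewrite -[X in _ --> X](mulr0 (2 * expR (- (d / 2)) / sigma)).
  by apply: cvgM; [exact: cvg_cst|exact: (noise_scale_cvg0 d sigma_gt0 n_cvg n_gt)].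
have mpsc_cvg : m%:R * p m * (s m * c m) @[m --> \oo] --> (0 : R).
  apply: (@squeeze_cvgr _ _ _ _ (cst 0)
    (fun m => 2 * sigma * (m%:R * p m * Num.sqrt (ln (n m)%:R / (n m)%:R)))); last 2 first.
  - exact: cvg_cst.
  - rewrite -[X in _ --> X](mulr0 (2 * sigma)).
    by apply: cvgM; first exact: cvg_cst.
  near=> m.
  have /andP[p_gt0 _] := p_itv m.
  have cm : 0 < c m by near: m; exact: c_gt0.
  have mp_ge0 : 0 <= m%:R * p m by rewrite mulr_ge0// ltW.
  have nR0 : 0 < (n m)%:R :> R by rewrite ltr0n.
  have sn0 : 0 < Num.sqrt (n m)%:R :> R by rewrite sqrtr_gt0.
  have pen_le : penalty d n m <= 4 * ln (n m)%:R.
    by near: m; exact: (penalty_le d n_cvg n_gt).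
  have ln_ge0 : 0 <= ln (n m)%:R :> R by apply: ln_ge0; rewrite ler1n.
  apply/andP; split; first by apply: mulr_ge0 => //; apply/ltW/mulr_gt0.
  rewrite [leRHS]mulrCA ler_wpM2l// sqrtrM// sqrtrV ?ler0n//.
  rewrite /s /noise_scale (_ : 2 * sigma * _ =
    sigma / Num.sqrt (n m)%:R * (2 * Num.sqrt (ln (n m)%:R))); last by ring.
  rewrite ler_wpM2l//; first by apply/ltW/divr_gt0.
  apply: le_trans (ler_wsqrtr pen_le) _.
  rewrite sqrtrM// (_ : 4 = 2 ^+ 2 :> R) ?sqrtr_sqr ?ger0_norm//.
  by ring.
rewrite -[X in _ --> X](addr0 0); apply: cvgD.
  apply: cvg_trans noise_cvg; apply: near_eq_cvg; near=> m.
  have m_gt0 : 0 < m%:R :> R by rewrite ltr0n; near: m; exists 1%N.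
  have sn0 : 0 < Num.sqrt (n m)%:R :> R by rewrite sqrtr_gt0 ltr0n.
  have -> : expR (- (c m ^+ 2 / 2)) = expR (- (d / 2)) / (Num.sqrt (n m)%:R * m%:R).
    by near: m; exact: (expR_cutoff d n_cvg n_gt).
  rewrite /s /noise_scale; field.
  by rewrite !gt_eqF.
rewrite -(mul0r (rhom + rhop)).
apply: cvg_trans (cvgM mpsc_cvg miss_c); apply: near_eq_cvg; near=> m.
have cm : 0 < c m by near: m; exact: c_gt0.
have sm := s_gt0 m.
by rewrite /=; field; rewrite !gt_eqF.
Unshelve. all: by end_near.
Qed.

Lemma mBIC_consistent : P m (@correct m) @[m --> \oo] --> 1%E.
Proof.
have fineE m : fine (P m (~` @correct m)) = 1 - fine (P m (@correct m)).
  rewrite probability_setC ?fineB ?fin_num_measure//; exact: measurable_correct_mbic.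
have wrong0 : fine (P m (~` @correct m)) @[m --> \oo] --> (0 : R).
  apply: (squeeze_cvgr _ (@cvg_cst _ 0 _ \oo _) error_bound_cvg0).
  near=> m; rewrite fine_ge0//= -lee_fin fineK; last first.
    by rewrite fin_num_measure//; apply: measurableC; exact: measurable_correct_mbic.
  by near: m; exact: prob_incorrect_le.
apply/fine_cvgP; split.
  by apply: nearW => m; rewrite fin_num_measure//; exact: measurable_correct_mbic.
rewrite -[X in _ --> X](subr0 1).
rewrite (_ : fine \o _ = (fun m => 1 - fine (P m (~` @correct m)))).
  by apply: cvgB; [exact: cvg_cst|exact: wrong0].
by apply/funext => m; rewrite fineE opprB addrC subrK.
Unshelve. all: by end_near.
Qed.

End Consistency.
End SparseSelection.

Theorem theorem3p1 (R : realType)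
  (sigma : R) (nu : probability R R)
  (n : nat -> nat) (p delta0 deltaA b0 : nat -> R)
  (X : forall m, 'M[R]_(n m, m.+1))
  (disp : nat -> measure_display) (T : forall m, measurableType (disp m))
  (P : forall m, probability (T m) R)
  (beta : forall m, 'I_m -> {RV (P m) >-> R})
  (eps : forall m, 'I_(n m) -> {RV (P m) >-> R})
  (d : R) (mbic : forall m, 'cV[R]_(n m) -> {set 'I_m})
  (sigma_gt0 : 0 < sigma)
  (nu_zero : nu [set 0] = 0%E)
  (nu_neg : (0 < nu [set x | (x < 0)%R])%E)
  (nu_pos : (0 < nu [set x | (0 < x)%R])%E)
  (n_gt0 : forall m, (0 < n m)%N)
  (p_itv : forall m, 0 < p m < 1)
  (delta0_gt0 : forall m, 0 < delta0 m) (deltaA_gt0 : forall m, 0 < deltaA m)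
  (X_orth : forall m, orthogonal_design (X m))
  (model : forall m, sparse_model (@beta m) (@eps m) sigma (p m) nu)
  (hB : assumption_B n p (fun m => delta0 m / deltaA m))
  (hC : assumption_C nu)
  (mbic_min : forall m, is_mBIC_rule sigma d (X m) (@mbic m))
  (mbic_meas : forall m,
     measurable_rule (X m) (b0 m) (@beta m) (@eps m) (@mbic m)) :
  (forall s : \bar R, (0 < s)%E ->
     (m%:R * p m)%:E @[m --> \oo] --> s ->
     ln (m%:R * p m) / ln (n m)%:R @[m --> \oo] --> (0 : R) ->
     fine (risk (X m) (b0 m) (@beta m) (@eps m) (delta0 m) (deltaA m) (@mbic m))
     / fine (risk (X m) (b0 m) (@beta m) (@eps m) (delta0 m) (deltaA m)
               (bayes_oracle sigma nu (p m) (delta0 m) (deltaA m) (X m)))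
       @[m --> \oo] --> (1 : R))
  /\
  (forall s : \bar R, (0 < s)%E ->
     (m%:R * p m)%:E @[m --> \oo] --> s ->
     m%:R * p m * Num.sqrt (ln (n m)%:R / (n m)%:R) @[m --> \oo] --> (0 : R) ->
     P m [set w | mbic m (response (X m) (b0 m) (@beta m) (@eps m) w)
                  = true_model (@beta m) w]
       @[m --> \oo] --> 1%E).
Proof.
have [e0 [K [rhom [rhop [rho [e0_gt0 [mrho rhoK] nuE [rhom_gt0 rho_left]
  [rhop_gt0 rho_right]]]]]]] := hC.
have nuP := PriorNear0 e0_gt0 mrho rhoK nuE rhom_gt0 rho_left rhop_gt0 rho_right nu_zero.
have [n_cvg p_cvg lo [Delta delta_le]] := hB.
have delta_o (e : R) : 0 < e ->
    \forall m \near \oo, `|ln (delta0 m / deltaA m)| <= e * `|ln (p m)|.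
  by move=> e_gt0; move/eqoP : lo => /(_ _ e_gt0).
split=> lim lim_gt0 mp_cvg; last first.
  exact: (mBIC_consistent sigma_gt0 nuP n_gt0 p_itv X_orth model n_cvg mbic_min mbic_meas).
have [r r_gt0 mp_ge] : exists2 r : R, 0 < r & \forall m \near \oo, r <= m%:R * p m.
  move: lim lim_gt0 mp_cvg => [x|_|//]; last by move=> /cvgeyPge /(_ 1) h; exists 1.
  rewrite lte_fin => x0 /fine_cvgP[_ /cvgrPdist_le /(_ (x / 2))].
  have x20 : 0 < x / 2 by rewrite divr_gt0.
  move=> /(_ x20) h; exists (x / 2) => //; apply: filterS h => m /=.
  by rewrite ler_norml => /andP[_]; lra.
exact: (mBIC_ABOS sigma_gt0 nuP n_gt0 p_itv delta0_gt0 deltaA_gt0 X_orth model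
  n_cvg p_cvg delta_le delta_o mbic_min mbic_meas r_gt0 mp_ge).
Qed.
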